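(* Let $G$ be a graph of order $n$. Then $\phi(G)\le 10^{n/5}$. Furthermore, $\phi(G)=10^{n/5}$ if and only if $n\equiv 0\pmod 5$ and $G$ is the disjoint union of $n/5$ graphs, each of which is isomorphic to a graph obtained from $K_5$ by deleting $i$ pairwise non-adjacent edges (i.e., a matching of size $i$) for some $0\le i\le 2$.
   Context: All graphs are finite, simple, undirected and labeled. A subset $F$ of vertices of a graph $G$ is a dissociation set if the induced subgraph $G[F]$ has maximum degree at most $1$. A maximal dissociation set is a dissociation set that is not a proper subset of any other dissociation set. $\phi(G)$ denotes the number of maximal dissociation sets of $G$. *)

(* Defs.v *)
From mathcomp Require Import all_boot.
From Stdlib Require Import Reals.

Set Implicit Arguments.
Unset Strict Implicit.
Unset Printing Implicit Defensive.

Definition simple_graph (T : finType) (e : rel T) : Prop :=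
  symmetric e /\ irreflexive e.

Definition dissociation (T : finType) (e : rel T) (F : {set T}) : bool :=
  [forall x in F, #|[set y in F | e x y]| <= 1].

Definition maximal_dissociation (T : finType) (e : rel T) (F : {set T}) : bool :=
  dissociation e F &&
  [forall F' : {set T}, (F \proper F') ==> ~~ dissociation e F'].

Definition phi (T : finType) (e : rel T) : nat :=
  #|[set F : {set T} | maximal_dissociation e F]|.

Definition matching5 (M : {set {set 'I_5}}) : bool :=
  [forall m in M, #|m| == 2] &&
  [forall m1 in M, forall m2 in M, (m1 != m2) ==> [disjoint m1 & m2]].

Definition K5_minus (M : {set {set 'I_5}}) : rel 'I_5 :=
  fun a b => (a != b) && ([set a; b] \notin M).

Definition induced_iso (T S : finType) (e : rel T) (B : {set T}) (f : rel S) :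
  Prop :=
  exists g : S -> T, [/\ injective g, g @: [set: S] = B &
                         forall a b, e (g a) (g b) = f a b].

Definition K5_minus_matching_block (T : finType) (e : rel T) (B : {set T}) :
  Prop :=
  exists (i : nat) (M : {set {set 'I_5}}),
    [/\ i <= 2, matching5 M, #|M| = i & induced_iso e B (K5_minus M)].

Definition disjoint_union_K5_minus_matchings (T : finType) (e : rel T)
  (k : nat) : Prop :=
  exists P : {set {set T}},
    [/\ partition P [set: T], #|P| = k,
        (forall B, B \in P -> K5_minus_matching_block e B) &
        (forall B1 B2 x y, B1 \in P -> B2 \in P -> x \in B1 -> y \in B2 ->
           e x y -> B1 = B2)].

(* Main.v *)
(** Write y = 10^(-1/5) and let f(A) be the number of maximal dissociation sets of G[A]; the
    claim is f(A) y^|A| <= 1.  If C is a pair (or singleton) contained in F without neighbours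
    in F \ C, then F \ C is maximal in A \ N[C], so by induction at most y^(|N[C]|-|A|) maximal
    sets F arise this way from a given C.  Every maximal F contains such a C meeting N[v], for
    any vertex v: otherwise v could be added.  Summing y^|N[C]| over the possible C near a
    well-chosen v gives a total below 1 in all cases but one.  A vertex of degree at least 4
    is handled by splitting on v in F or not (a set avoiding v stays maximal in A \ v, which
    costs y); leaves, vertices of degree 2 and cubic graphs are treated directly.  The exception
    is a component K with 5 vertices and all degrees at least 3, i.e. K5 minus a matching: there
    the traces F \cap K are exactly the 10 pairs, so f(A) = 10 f(A \ K) and equality is
    inherited from A \ K. *)
Require Import Defs.
From mathcomp Require Import all_boot.
From Stdlib Require Import Reals Lra.

Set Implicit Arguments.
Unset Strict Implicit.
Unset Printing Implicit Defensive.

(** * Numerical bounds on powers of 10^(-1/5) *)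

Definition y : R := Rpower 10 (- (1 / 5)).

Lemma y_gt0 : (0 < y)%R.
Proof. exact: exp_pos. Qed.

Lemma y5 : (y ^ 5 = 1 / 10)%R.
Proof.
rewrite -Rpower_pow; last exact: y_gt0.
rewrite Rpower_mult (_ : (- (1 / 5) * INR 5 = - 1)%R); last by rewrite /=; field.
by rewrite Rpower_Ropp Rpower_1; lra.
Qed.

Lemma y_lt : (y < 631 / 1000)%R.
Proof.
(* The fifth power of 0.631 is just above 1/10, so 631/1000 <= y would contradict [y5]. *)
case: (Rlt_le_dec y (631 / 1000)) => // hy.
have h0 : (0 <= 631 / 1000)%R by lra.
have := pow_incr _ _ 5 (conj h0 hy); rewrite y5 /=; lra.
Qed.

Lemma y2_lt : (y ^ 2 < 39817 / 100000)%R.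
Proof. have := y_lt; have := y_gt0; rewrite /=; nra. Qed.

Lemma y3_lt : (y ^ 3 < 25125 / 100000)%R.
Proof.
have := y2_lt; have := y_lt; have := y_gt0 => h1 h2 h3.
have -> : (y ^ 3 = y * y ^ 2)%R by ring.
have : (0 < y ^ 2)%R by apply: pow_lt.
nra.
Qed.

Lemma y4_lt : (y ^ 4 < 15855 / 100000)%R.
Proof.
have := y3_lt; have := y_lt; have := y_gt0 => h1 h2 h3.
have -> : (y ^ 4 = y * y ^ 3)%R by ring.
have : (0 < y ^ 3)%R by apply: pow_lt.
nra.
Qed.

Lemma y6_lt : (y ^ 6 < 631 / 10000)%R.
Proof.
have -> : (y ^ 6 = y * y ^ 5)%R by ring.
have := y_lt; rewrite y5; lra.
Qed.

Lemma pow_y_le m n : n <= m -> (y ^ m <= y ^ n)%R.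
Proof.
move=> /subnK <-; elim: (m - n) => [|k IH]; first exact: Rle_refl.
rewrite addSn /=; have := pow_lt y (k + n) y_gt0; have := y_lt; nra.
Qed.

(** Passing from d to d + 1 multiplies the left side by y (d + 1) / d, which is below 1 once d is at
    least 2. It bounds d pairs that each dominate d + 1 vertices. *)
Lemma mul_pow_le k d : 1 < k -> k <= d -> (INR d * y ^ d.+1 <= INR k * y ^ k.+1)%R.
Proof.
move=> k1; elim: d => [|d IHd]; first by rewrite leqn0 => /eqP ->; lra.
rewrite leq_eqVlt => /predU1P[->|]; first lra.
rewrite ltnS => kd; apply: Rle_trans (IHd kd).
have h2 : (2 <= INR d)%R by have := le_INR _ _ (elimT leP (leq_trans k1 kd)); rewrite /=; lra.
rewrite -(tech_pow_Rmult y d.+1) S_INR.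
have := pow_lt y d.+1 y_gt0; have := y_lt; have := y_gt0 => h3 h4 h5.
have h6 : ((INR d + 1) * y <= INR d)%R by nra.
nra.
Qed.

(** * Maximal dissociation sets of induced subgraphs *)

Section Branching.
Context {T : finType}.
Variable e : rel T.
Hypotheses (eS : symmetric e) (eI : irreflexive e).

Implicit Types (A B C F G K : {set T}) (P : {set {set T}}) (a b c p q r u v w x z : T).

(** Maximality is tested by adding one vertex only; [phi_mds] reconciles this with maximality under
    inclusion. *)
Definition mds A : {set {set T}} :=
  [set F : {set T} | [&& F \subset A, dissociation e F
                       & [forall w in A :\: F, ~~ dissociation e (w |: F)]]].

(** Three shapes are covered: an edge of G[F], an isolated vertex of G[F] ([a = b]), and two
    isolated vertices taken together. *)
Definition closed_pair F a b :=
  [&& a \in F, b \in F & [forall z in F, (e a z || e b z) ==> (z == a) || (z == b)]].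

Definition dom A a b := [set z in A | [|| z == a, z == b, e a z | e b z]].

(** The count divided by the claimed maximum 10^(|A|/5); the bound to prove becomes [g A <= 1]. *)
Definition g A : R := (INR #|mds A| * y ^ #|A|)%R.

Lemma dissP F :
  reflect (forall x u w, x \in F -> u \in F -> w \in F -> e x u -> e x w -> u = w)
          (dissociation e F).
Proof.
apply: (iffP forall_inP) => [h x u w xF uF wF xu xw|h x xF].
  by apply: (card_le1_eqP (h x xF)); rewrite inE ?uF ?wF.
by apply/card_le1_eqP => u w; rewrite !inE => /andP[uF xu] /andP[wF xw]; apply: (h x).
Qed.

Lemma dissS F F' : F \subset F' -> dissociation e F' -> dissociation e F.
Proof.
move=> /subsetP s /dissP h; apply/dissP => x u w /s xF /s uF /s wF.
exact: h.
Qed.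

Lemma mdsP A F :
  reflect [/\ F \subset A, dissociation e F
            & forall w, w \in A -> w \notin F -> ~~ dissociation e (w |: F)]
          (F \in mds A).
Proof.
rewrite inE; apply: (iffP and3P) => [[h1 h2 /forall_inP h3]|[h1 h2 h3]]; split=> //.
  by move=> w wA wF; apply: h3; rewrite inE wF.
by apply/forall_inP => w; rewrite inE => /andP[wF wA]; apply: h3.
Qed.

(** * Removal of closed pairs and the branching inequality *)

Lemma closed_pairP F a b :
  reflect [/\ a \in F, b \in F & forall z, z \in F -> e a z || e b z -> z = a \/ z = b]
          (closed_pair F a b).
Proof.
apply: (iffP and3P) => [[h1 h2 /forall_inP h3]|[h1 h2 h3]]; split=> //.
  by move=> z zF ez; move/implyP: (h3 z zF) => /(_ ez) /orP[]/eqP; [left|right].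
by apply/forall_inP => z zF; apply/implyP => /(h3 z zF) [] ->; rewrite eqxx ?orbT.
Qed.

Lemma closed_pairC F a b : closed_pair F a b = closed_pair F b a.
Proof.
rewrite /closed_pair andbCA; do 2!congr (_ && _).
by apply: eq_forallb => z; rewrite orbC [(z == b) || _]orbC.
Qed.

(** No edge joins {a, b} to the rest of F or to a vertex w outside [dom A a b]. Hence a w that fits
    into F minus {a, b} would also fit into F. *)
Lemma mds_closed A F a b : F \in mds A -> closed_pair F a b ->
  F :\: [set a; b] \in mds (A :\: dom A a b).
Proof.
move=> /mdsP[sF dF mF] /closed_pairP[aF bF cF]; apply/mdsP; split.
- apply/subsetP => z; rewrite !inE negb_or => /andP[/andP[za zb] zF].
  rewrite (subsetP sF _ zF) andbT /= (negPf za) (negPf zb) /=.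
  by apply/negP => /(cF z zF) [] E; rewrite E eqxx in za zb.
- exact: dissS (subsetDl _ _) dF.
move=> w; rewrite !inE => /andP[wd wA]; move: wd; rewrite wA /=.
rewrite !negb_or => /and4P[wa wb eaw ebw]; rewrite wa wb /= => wF.
apply: contra (mF w wA wF) => /dissP h; apply/dissP.
have nbr x u : x \in w |: F -> u \in w |: F -> e x u -> x = a \/ x = b -> u = a \/ u = b.
  move=> _ uF xu hx; have euo : e a u || e b u by case: hx xu => -> ->; rewrite ?orbT.
  move: uF; rewrite !inE => /orP[/eqP E|uF]; last exact: cF.
  by rewrite E (negPf eaw) (negPf ebw) in euo.
move=> x u z xF uF zF xu xz.
(* If x is a or b, its only possible neighbour is the other one; otherwise x and its neighbours all
   survive the removal of {a, b}. *)
have [/orP xab|xab] := boolP ((x == a) || (x == b)).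
  have hx : x = a \/ x = b by case: xab => /eqP; [left|right].
  have := nbr _ _ xF uF xu hx; have := nbr _ _ xF zF xz hx.
  by case: hx xu xz => -> xu xz [] E1 [] E2; move: xu xz; rewrite E1 E2 ?eI.
have nab t : t \in w |: F -> e x t -> ~~ ((t == a) || (t == b)).
  move=> tF xt; apply: contra xab => /orP ht.
  have ht' : t = a \/ t = b by case: ht => /eqP; [left|right].
  by case: (nbr t x tF xF _ ht'); rewrite 1?eS // => ->; rewrite eqxx ?orbT.
have sub t : t \in w |: F -> ~~ ((t == a) || (t == b)) -> t \in w |: F :\: [set a; b].
  by rewrite !inE => /orP[->//|->] ->; rewrite orbT.
apply: (h x) => //; apply: sub => //; exact: nab.
Qed.

(** Putting a and b back recovers F, so the removal in [mds_closed] is injective. *)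
Lemma card_closed A a b (Q : pred {set T}) :
  #|[set F in mds A | Q F & closed_pair F a b]| <= #|mds (A :\: dom A a b)|.
Proof.
rewrite -(@card_in_imset _ _ (fun F => F :\: [set a; b])).
  apply: subset_leq_card; apply/subsetP => _ /imsetP[F hF ->].
  by move: hF; rewrite inE => /and3P[mF _ cF]; apply: mds_closed.
have rec F : F \in [set F in mds A | Q F & closed_pair F a b] ->
    F = [set a; b] :|: (F :\: [set a; b]).
  rewrite inE => /and3P[_ _ /closed_pairP[aF bF _]].
  rewrite setDE setUIr setUCr setIT; apply/esym/setUidPr.
  by apply/subsetP => z; rewrite !inE => /orP[]/eqP->.
by move=> F1 F2 /rec E1 /rec E2 E; rewrite E1 E2 E.
Qed.

Lemma dom_sub A a b : dom A a b \subset A.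
Proof. by apply/subsetP => z; rewrite inE => /andP[]. Qed.

Lemma gD A B : B \subset A -> (g (A :\: B) * y ^ #|B| = INR #|mds (A :\: B)| * y ^ #|A|)%R.
Proof.
move=> sBA; rewrite /g -(cardsID B A) (setIidPr sBA) -plusE pow_add; ring.
Qed.

(* An item ((a, b), s) stands for the closed pair {a, b} (a singleton if a = b) together with a
   list s of distinct vertices of N[{a, b}], which bounds the gain of branching on it. *)
Definition item : Type := (T * T * seq T)%type.
Definition valid A (i : item) := uniq i.2 && all (mem (dom A i.1.1 i.1.2)) i.2.
Definition wt (L : seq item) : R := foldr (fun (i : item) t => (y ^ (size i.2) + t)%R) 0%R L.

(** Each F is charged to the first pair of [L] closed in it, and [Q] shrinks along the list to the
    sets not yet charged. By induction a pair C contributes at most y^|N[C]|, and the size of its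
    list s is a lower bound for |N[C]|. *)
Lemma branch A (Q : pred {set T}) (L : seq item) :
  (forall B, B \proper A -> (g B <= 1)%R) ->
  all (valid A) L ->
  (forall F, F \in mds A -> Q F -> has (fun i => closed_pair F i.1.1 i.1.2) L) ->
  (INR #|[set F in mds A | Q F]| * y ^ #|A| <= wt L)%R.
Proof.
move=> IH; elim: L Q => [|[[a b] s] L IHL] Q /=.
  move=> _ h; rewrite (_ : [set F in mds A | Q F] = set0) ?cards0 /=; first lra.
  by apply/setP => F; rewrite inE in_set0; apply/negP => /andP[h1 h2]; have := h F h1 h2.
move=> /andP[/andP[/= us ds] vL] cov.
set X := [set F in mds A | Q F].
set X1 := [set F in mds A | Q F & ~~ closed_pair F a b].
have hX1 : (INR #|X1| * y ^ #|A| <= wt L)%R.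
  apply: (IHL (fun F => Q F && ~~ closed_pair F a b)) => // F mF /andP[PF nF].
  by have := cov F mF PF; rewrite (negPf nF).
set X2 := [set F in mds A | Q F & closed_pair F a b].
have cX : #|X| = #|X2| + #|X1|.
  rewrite -(cardsID [set F | closed_pair F a b] X); congr (_ + _);
    by apply: eq_card => F; rewrite !inE; case: (closed_pair F a b); rewrite ?andbT ?andbF.
rewrite cX -plusE plus_INR Rmult_plus_distr_r; apply: Rplus_le_compat => //.
(* A member of [X2] puts a in A, so removing the dominated vertices leaves a proper subset of A; an
   empty [X2] contributes nothing. *)
case: (set_0Vmem X2) => [->|[F]].
  rewrite cards0 /= Rmult_0_l; apply: Rlt_le; apply: pow_lt; exact: y_gt0.
rewrite inE => /and3P[/mdsP[sF _ _] _ /closed_pairP[aF _ _]].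
have aA := subsetP sF _ aF.
apply: (@Rle_trans _ (INR #|mds (A :\: dom A a b)| * y ^ #|A|)%R).
  apply: Rmult_le_compat_r; first by apply: Rlt_le; apply: pow_lt; exact: y_gt0.
  by apply: le_INR; apply/leP; apply: card_closed.
rewrite -(gD (dom_sub A a b)).
have pr : A :\: dom A a b \proper A.
  apply/properP; split; first exact: subsetDl.
  by exists a => //; rewrite !inE aA eqxx.
have := IH _ pr => h.
have hs : size s <= #|dom A a b|.
  by rewrite cardE; apply: uniq_leq_size => // z zs; rewrite mem_enum; apply: (allP ds).
have := pow_y_le hs; have := pow_lt y #|dom A a b| y_gt0; nra.
Qed.

(** * Closed pairs near a given vertex *)

Lemma blocked A F v : F \in mds A -> v \in A -> v \notin F ->
  exists x p q, [/\ x \in v |: F, p \in v |: F, q \in v |: F & [/\ p != q, e x p & e x q]].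
Proof.
move=> /mdsP[_ _ mF] vA /(mF v vA); rewrite negb_forall_in => /exists_inP[x xF].
rewrite -ltnNge => /card_gt1P[p [q [hp hq pq]]].
move: hp hq; rewrite [_ \in _]inE => /andP[pF xp]; rewrite inE => /andP[qF xq].
by exists x, p, q.
Qed.

Lemma mds_in A F v : F \in mds A -> v \in F ->
  closed_pair F v v \/ exists2 u, [/\ u \in A, u != v & e v u] & closed_pair F v u.
Proof.
move=> /mdsP[sF /dissP dF _] vF.
have [/exists_inP[u uF vu]|/exists_inPn h] := boolP [exists u in F, e v u].
  right; exists u; first split=> //; first exact: (subsetP sF).
    by apply: contraTneq vu => ->; rewrite eI.
  apply/closed_pairP; split=> // z zF /orP[vz|uz]; first by right; apply: (dF v).
  by left; apply: (dF u) => //; rewrite eS.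
left; apply/closed_pairP; split=> // z zF; rewrite orbb => vz.
by have := h z zF; rewrite vz.
Qed.

(** Otherwise u would see only v in F, and u could be added, matched with v. *)
Lemma isolated_nbr A F v u : F \in mds A -> closed_pair F v v -> u \in A -> e v u ->
  exists z, [/\ z \in F, z \in A, z != v, e u z & ~~ e v z].
Proof.
move=> mF /closed_pairP[vF _ cF] uA vu; have /mdsP[sF /dissP dF _] := mF.
have vN z : z \in F -> ~~ e v z.
  move=> zF; apply/negP => vz; have : z = v \/ z = v by apply: cF; rewrite ?vz.
  by case=> E; move: vz; rewrite E eI.
have uF : u \notin F by apply: contraL vu; apply: vN.
have [x [p [q [xF pF qF [pq xp xq]]]]] := blocked mF uA uF.
have [/exists_inP[z zF /andP[zv uz]]|/exists_inPn h] :=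
  boolP [exists z in F, (z != v) && e u z].
  by exists z; split=> //; [apply: (subsetP sF)|apply: vN].
have h' z : z \in F -> e u z -> z = v.
  by move=> zF uz; have := h z zF; rewrite uz andbT negbK => /eqP.
case/negP: pq; apply/eqP; move: xF; rewrite in_setU1 => /predU1P[E|xF].
  subst x; move: pF qF; rewrite !in_setU1 => /predU1P[E|pF]; first by rewrite E eI in xp.
  by move=> /predU1P[E|qF]; [rewrite E eI in xq|rewrite (h' p pF xp) (h' q qF xq)].
have no r : r \in u |: F -> e x r -> e x u -> r = u.
  move=> rF xr xu; have Ev : x = v by apply: h'; rewrite // eS.
  move: rF; rewrite in_setU1 => /predU1P[//|rF].
  by rewrite Ev in xr; have := vN r rF; rewrite xr.
move: pF qF; rewrite !in_setU1 => /predU1P[E|pF].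
  by move=> qF; rewrite E; apply/esym/no; rewrite ?in_setU1 // -E.
move=> /predU1P[E|qF]; last exact: (dF x).
by rewrite E; apply: no; rewrite ?in_setU1 ?pF ?orbT // -E.
Qed.

(** The last two cases are the ways in which F can block v: a neighbour of v in F is matched, or two
    neighbours in F are isolated. [AroundTwo] keeps three closed pairs, so that any of them may be
    the one listed in a branching. *)
Variant around_spec A F v : Prop :=
| AroundSelf of closed_pair F v v
| AroundNbr u of u \in A & e v u & closed_pair F v u
| AroundOut u w of u \in A & e v u & w \in A & e u w & w != v & closed_pair F u w
| AroundTwo u w of u \in A & e v u & w \in A & e v w & u != w & ~~ e u w
    & closed_pair F u u & closed_pair F w w & closed_pair F u w.

(** Adding an excluded v creates a vertex x with two neighbours. If x = v, these are neighbours of v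
    in F, one of them matched or both isolated; if x is in F, then x is a neighbour of v that is
    already matched. *)
Lemma around A F v : F \in mds A -> v \in A -> around_spec A F v.
Proof.
move=> mF vA; have /mdsP[sF /dissP dF _] := mF.
have [vF|vF] := boolP (v \in F).
  have [|[u [uA _ vu] c]] := mds_in mF vF; first exact: AroundSelf.
  exact: (AroundNbr uA vu c).
have out u : u \in F -> e v u -> (exists2 w, [/\ w \in A, w != v & e u w] & closed_pair F u w) ->
    around_spec A F v.
  by move=> uF vu [w [wA wv uw] c]; apply: (AroundOut (subsetP sF _ uF) vu wA uw).
have out2 u w : u \in F -> e v u -> w \in F -> e u w -> around_spec A F v.
  move=> uF vu wF uw; have [c|[w' [w'A w'u uw'] c]] := mds_in mF uF.
    have [_ _ /(_ w wF)] := closed_pairP _ _ _ c.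
    by rewrite uw => /(_ isT) [] E; rewrite E eI in uw.
  apply: (out u) => //; exists w' => //; split=> //.
  by apply: contraNneq vF => <-; case/closed_pairP: c.
have [x [p [q [xF pF qF [pq xp xq]]]]] := blocked mF vA vF.
move: xF; rewrite in_setU1 => /predU1P[E|xF].
  subst x; move: pF qF; rewrite !in_setU1 => /predU1P[E|pF]; first by rewrite E eI in xp.
  move=> /predU1P[E|qF]; first by rewrite E eI in xq.
  have [cp|] := mds_in mF pF; last first.
    case=> w [wA wp pw] c; apply: (out p) => //; exists w => //; split=> //.
    by apply: contraNneq vF => <-; case/closed_pairP: c.
  have [cq|] := mds_in mF qF; last first.
    case=> w [wA wp pw] c; apply: (out q) => //; exists w => //; split=> //.
    by apply: contraNneq vF => <-; case/closed_pairP: c.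
  have npq : ~~ e p q.
    apply/negP => epq; have [_ _ /(_ q qF)] := closed_pairP _ _ _ cp.
    by rewrite epq => /(_ isT) [] E; rewrite E eqxx in pq.
  have c : closed_pair F p q.
    apply/closed_pairP; split=> // z zF /orP[pz|qz].
      by have [_ _ /(_ z zF)] := closed_pairP _ _ _ cp; rewrite pz => /(_ isT) []; left.
    by have [_ _ /(_ z zF)] := closed_pairP _ _ _ cq; rewrite qz => /(_ isT) []; right.
  exact: (AroundTwo (subsetP sF _ pF) xp (subsetP sF _ qF) xq pq npq cp cq c).
have vx : e x v -> e v x by rewrite eS.
move: pF qF; rewrite !in_setU1 => /predU1P[E|pF].
  move=> /predU1P[E'|qF]; first by rewrite E E' eqxx in pq.
  by apply: (out2 x q) => //; apply: vx; rewrite -E.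
move=> /predU1P[E|qF]; first by apply: (out2 x p) => //; apply: vx; rewrite -E.
by case/negP: pq; apply/eqP; apply: (dF x).
Qed.

(** * Enumeration of neighbours inside A *)

Definition nb A v := [set u in A | e v u].

Lemma nb_extra A v (s : seq T) : size s < #|nb A v| ->
  exists z, [/\ z \in A, e v z & z \notin s].
Proof.
move=> h; have /subsetPn[z] : ~~ (nb A v \subset s).
  by apply: contraL h => /subset_leq_card h; rewrite -leqNgt (leq_trans h) // card_size.
by rewrite inE => /andP[zA vz] zs; exists z.
Qed.

Lemma nb_all A v (s : seq T) : uniq s -> all (mem (nb A v)) s -> #|nb A v| <= size s ->
  forall z, z \in A -> e v z -> z \in s.
Proof.
move=> us /allP sN h z zA vz.
have E : nb A v =i s.
  have [] // := uniq_min_size (s1 := s) (s2 := enum (nb A v)) us.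
  - by move=> t /sN; rewrite mem_enum.
  - by rewrite -cardE.
  by move=> _ E' t; rewrite (E' t) mem_enum.
by rewrite -E inE zA.
Qed.

Lemma strict_branch A (L : seq item) :
  (forall B, B \proper A -> (g B <= 1)%R) ->
  all (valid A) L ->
  (forall F, F \in mds A -> has (fun i => closed_pair F i.1.1 i.1.2) L) ->
  (wt L < 1)%R -> (g A < 1)%R.
Proof.
move=> IH vL cov hL; have := branch (Q := predT) IH vL (fun F mF _ => cov F mF).
by rewrite (_ : [set F in _ | predT F] = mds A);
  [rewrite -/(g A); lra|apply/setP => F; rewrite inE andbT].
Qed.

Lemma nb1 A v a : #|nb A v| = 1 -> a \in A -> e v a ->
  forall z, z \in A -> e v z -> z = a.
Proof.
move=> d aA va z zA vz; have := @nb_all A v [:: a] isT _ _ z zA vz.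
by rewrite /= !inE aA va d => /(_ isT isT) /eqP.
Qed.

Lemma nb2 A v a : #|nb A v| = 2 -> a \in A -> e v a ->
  exists b, [/\ b \in A, e v b, b != a &
                forall z, z \in A -> e v z -> z = a \/ z = b].
Proof.
move=> d aA va; have [|b [bA vb ba]] := @nb_extra A v [:: a]; first by rewrite d.
rewrite inE in ba; exists b; split=> // z zA vz.
have := @nb_all A v [:: a; b] _ _ _ z zA vz.
rewrite /= !inE aA va bA vb d eq_sym ba => /(_ isT isT isT) /orP[]/eqP; tauto.
Qed.

Lemma nb3 A v a b : #|nb A v| = 3 -> a \in A -> e v a -> b \in A -> e v b -> a != b ->
  exists c, [/\ c \in A, e v c, c != a, c != b &
                forall z, z \in A -> e v z -> [\/ z = a, z = b | z = c]].
Proof.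
move=> d aA va bA vb ab; have [|c [cA vc]] := @nb_extra A v [:: a; b]; first by rewrite d.
rewrite !inE negb_or => /andP[ca cb]; exists c; split=> // z zA vz.
have := @nb_all A v [:: a; b; c] _ _ _ z zA vz.
rewrite /= !inE aA va bA vb cA vc d negb_or ab eq_sym ca [b == c]eq_sym cb.
by move=> /(_ isT isT isT) /or3P[]/eqP; [constructor 1|constructor 2|constructor 3].
Qed.

Lemma nb3_1 A v a : #|nb A v| = 3 -> a \in A -> e v a ->
  exists b c, [/\ b \in A, e v b, c \in A & e v c] /\ [/\ b != a, c != a, c != b &
                forall z, z \in A -> e v z -> [\/ z = a, z = b | z = c]].
Proof.
move=> d aA va; have [|b [bA vb]] := @nb_extra A v [:: a]; first by rewrite d.
rewrite inE => ba; rewrite eq_sym in ba.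
have [c [cA vc ca cb h]] := nb3 d aA va bA vb ba.
by exists b, c; do 2!split=> //; rewrite eq_sym.
Qed.

Lemma nb_extra1 A v a : 1 < #|nb A v| -> exists z, [/\ z \in A, e v z & z != a].
Proof.
by move=> /(@nb_extra A v [:: a]) [z [zA vz]]; rewrite inE => za; exists z.
Qed.

Lemma nb_extra2 A v a b : 2 < #|nb A v| ->
  exists z, [/\ z \in A, e v z, z != a & z != b].
Proof.
move=> /(@nb_extra A v [:: a; b]) [z [zA vz]]; rewrite !inE negb_or => /andP[za zb].
by exists z.
Qed.

(** A neighbour of p in F would be a neighbour of v in F, and v has none; so p is isolated too and
    joins v in a closed pair. *)
Lemma closed_twin A F v p : F \in mds A -> closed_pair F v v -> p \in F ->
  (forall z, z \in A -> e p z -> e v z) -> closed_pair F v p.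
Proof.
move=> /mdsP[sF _ _] /closed_pairP[vF _ cF] pF h; apply/closed_pairP; split=> // z zF.
move=> vpz; left; have [] // : z = v \/ z = v.
by apply: cF => //; case/orP: vpz => [->//|/(h z (subsetP sF z zF)) ->].
Qed.

(** * Automation for the local case analysis *)

Ltac absurd_now :=
  match goal with
  | H : is_true (e ?a ?a) |- _ => exfalso; rewrite eI in H; discriminate H
  | H : is_true (?a != ?a) |- _ => exfalso; rewrite eqxx in H; discriminate H
  | H : is_true (~~ e ?a ?b), K : is_true (e ?a ?b) |- _ =>
      exfalso; rewrite K in H; discriminate H
  | H : is_true (~~ e ?a ?b), K : is_true (e ?b ?a) |- _ =>
      exfalso; rewrite eS K in H; discriminate H
  end.

(* The tactics below read the local structure of the graph off hypotheses of the form
   [forall z, z \in A -> e v z -> z = a \/ ...], which list all neighbours of v in A. *)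
Ltac split_eqs := repeat match goal with
  | H : _ \/ _ |- _ => destruct H
  | H : or3 _ _ _ |- _ => destruct H
  end; subst.

Ltac edge := match goal with
  | H : is_true (e ?a ?b) |- is_true (e ?a ?b) => exact H
  | H : is_true (e ?b ?a) |- is_true (e ?a ?b) => rewrite eS; exact H
  end.

Ltac use_nbs := multimatch goal with
  | Hv : forall z, is_true (z \in ?A) -> is_true (e ?v z) -> _, H : is_true (e ?v ?a) |- _ =>
      destruct (Hv a ltac:(assumption) H); split_eqs
  | Hv : forall z, is_true (z \in ?A) -> is_true (e ?v z) -> _, H : is_true (e ?a ?v) |- _ =>
      destruct (Hv a ltac:(assumption) ltac:(edge)); split_eqs
  end.

Ltac absurd n := first [ absurd_now
  | lazymatch n with S ?m => use_nbs; absurd m end ].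

Ltac neq := first [ assumption | rewrite eq_sym; assumption
  | let E := fresh in apply/eqP => E; subst; solve [absurd constr:(2)] ].

Ltac solve_valid :=
  rewrite /= /valid /= ?inE ?negb_or; repeat (apply/andP; split=> //);
  rewrite ?inE ?eqxx ?orbT ?andbT //;
  first [ assumption | neq
        | repeat match goal with
                 | H : is_true (_ \in _) |- _ => rewrite H
                 | H : is_true (e ?a ?b) |- context [e ?a ?b] => rewrite H
                 | H : is_true (e ?a ?b) |- context [e ?b ?a] => rewrite (eS b a) H
                 end; by rewrite ?orbT ].

Ltac found := rewrite /=; match goal with
  | H : is_true (closed_pair ?F ?a ?b) |- context [closed_pair ?F ?a ?b] => by rewrite H ?orbT
  | H : is_true (closed_pair ?F ?a ?b) |- context [closed_pair ?F ?b ?a] =>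
      by rewrite (closed_pairC F b a) H ?orbT
  end.

Ltac nbs_of u := match goal with
  | Hv : forall z, is_true (z \in _) -> is_true (e ?v z) -> _, H : is_true (e ?v u) |- _ =>
      destruct (Hv u ltac:(assumption) H); split_eqs
  end.

Ltac solve_cover v :=
  let F := fresh "F" in let mF := fresh "mF" in
  move=> F mF; case: (@around _ F v mF ltac:(assumption));
  [ move=> ?; try found
  | let u := fresh "u" in move=> u ? ? ?; nbs_of u; try found
  | let u := fresh "u" in let w := fresh "w" in
    move=> u w ? ? ? ? ? ?; nbs_of u; try (nbs_of w; first [found | absurd_now])
  | let u := fresh "u" in let w := fresh "w" in
    move=> u w ? ? ? ? ? ? ? ? ?; nbs_of u; nbs_of w; first [absurd_now | found | idtac]].

(** For a u whose other neighbours are all adjacent to v: then v is never isolated in F, and the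
    singleton v may be missing from the list. *)
Ltac lone u := match goal with
  | mF : is_true (in_mem ?F _), H : is_true (closed_pair ?F ?v ?v) |- _ =>
      let z := fresh "z" in
      destruct (@isolated_nbr _ F v u mF H ltac:(assumption) ltac:(edge))
        as [z [? ? ? ? ?]]; nbs_of z; try absurd_now
  end.

(** If v is isolated in F, the further neighbour z of u in F has all its neighbours adjacent to v.
    The pair {v, z}, which dominates more vertices, then replaces the singleton v in the list. *)
Ltac twin u := match goal with
  | mF : is_true (in_mem ?F _), H : is_true (closed_pair ?F ?v ?v) |- _ =>
      let z := fresh "z" in let zF := fresh "zF" in
      destruct (@isolated_nbr _ F v u mF H ltac:(assumption) ltac:(edge))
        as [z [zF ? ? ? ?]];
      let c := fresh "c" in
      assert (c : is_true (closed_pair F v z));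
      [ nbs_of z; try absurd_now;
        apply: (closed_twin mF) => //; let t := fresh "t" in move=> t ? ?; nbs_of t; edge
      | nbs_of z; try absurd_now; found ]
  end.

Ltac solve_wt := rewrite /wt /=; have := y_lt; have := y2_lt; have := y3_lt; have := y4_lt;
  have := y6_lt; have := y5; rewrite /=; lra.

(** * Strict bounds in the induction step *)

Section Cases.
Variable A : {set T}.
Hypothesis IH : forall B, B \proper A -> (g B <= 1)%R.

Lemma isolated_strict v : v \in A -> #|nb A v| = 0 -> (g A < 1)%R.
Proof.
move=> vA d; have h u : u \in A -> e v u -> False.
  move=> uA vu; have : u \in nb A v by rewrite inE uA.
  by rewrite (cards0_eq d) inE.
apply: (strict_branch (L := [:: (v, v, [:: v])])) => //.
- by solve_valid.
- by move=> F mF; rewrite /=; case: (around mF vA) =>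
    [->//|u uA /(h u uA)//|u w uA /(h u uA)//|u w uA /(h u uA)//].
- solve_wt.
Qed.

(** * Maximum degree at most three *)

Lemma K3_strict v u w : v \in A -> u \in A -> w \in A -> e v u -> e v w -> e u w ->
  (forall z, z \in A -> e v z -> z = u \/ z = w) ->
  #|nb A u| = 2 -> #|nb A w| = 2 -> (g A < 1)%R.
Proof.
move=> vA uA wA vu vw uw hv du dw.
have [|x [xA ux xv hu]] := nb2 du vA _; first by edge.
have [|x' [xA' ux' xv' hw]] := nb2 dw vA _; first by edge.
have E : x = w by symmetry; case: (hu w wA uw) => // ?; subst; absurd constr:(2).
have E' : x' = u by symmetry; case: (hw u uA) => // [|?]; first edge; subst; absurd constr:(2).
subst.
apply: (strict_branch (L := [:: (v, u, [:: v; u; w]); (v, w, [:: v; u; w]);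
  (u, w, [:: v; u; w])])) => //.
- by solve_valid.
- by solve_cover v; lone u.
- solve_wt.
Qed.

(** The vertex u has one edge leaving the triangle; the total is y^3 + 3 y^4. *)
Lemma paw_strict v u w : v \in A -> u \in A -> w \in A -> e v u -> e v w -> e u w ->
  (forall z, z \in A -> e v z -> z = u \/ z = w) ->
  #|nb A u| = 3 -> #|nb A w| = 2 -> (g A < 1)%R.
Proof.
move=> vA uA wA vu vw uw hv du dw.
have [|x [xA wx xv hw]] := nb2 dw vA _; first by edge.
have E : x = u by symmetry; case: (hw u uA) => // [|?]; first edge; subst; absurd constr:(2).
subst.
have [||p [pA up pv pw hu]] := nb3 du vA _ wA uw _; [edge|neq|].
apply: (strict_branch (L := [:: (v, u, [:: v; u; w; p]); (v, w, [:: v; u; w]);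
  (u, w, [:: v; u; w; p]); (u, p, [:: v; u; w; p])])) => //.
- by solve_valid.
- by solve_cover v; lone w.
- solve_wt.
Qed.

(** The split is on the degrees of u and w and, if both are 3, on whether their outer neighbours p
    and q coincide. *)
Lemma deg2_triangle_strict v u w : v \in A -> u \in A -> w \in A ->
  e v u -> e v w -> e u w ->
  (forall z, z \in A -> e v z -> z = u \/ z = w) ->
  (forall z, z \in A -> 1 < #|nb A z| <= 3) -> (g A < 1)%R.
Proof.
move=> vA uA wA vu vw uw hv D.
have wu : e w u by edge.
have hv' z : z \in A -> e v z -> z = w \/ z = u by move=> zA /(hv z zA) []; tauto.
have /orP[/eqP du|/eqP du] : (#|nb A u| == 2) || (#|nb A u| == 3).
- by move: (D u uA); case: #|_| => [|[|[|[|]]]].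
- have /orP[/eqP dw|/eqP dw] : (#|nb A w| == 2) || (#|nb A w| == 3).
  + by move: (D w wA); case: #|_| => [|[|[|[|]]]].
  + exact: (K3_strict vA uA wA).
  + exact: (paw_strict vA wA uA).
have /orP[/eqP dw|/eqP dw] : (#|nb A w| == 2) || (#|nb A w| == 3).
- by move: (D w wA); case: #|_| => [|[|[|[|]]]].
- exact: (paw_strict vA uA wA).
clear hv'.
have [||p [pA up pv pw hu]] := nb3 du vA _ wA uw _; [edge|neq|].
have [||q [qA wq qv qu hw]] := nb3 dw vA _ uA wu _; [edge|neq|].
have [E|npq] := eqVneq p q; last first.
  apply: (strict_branch (L := [:: (v, v, [:: v; u; w]); (v, u, [:: v; u; w; p]);
    (v, w, [:: v; u; w; q]); (u, w, [:: u; w; v; p; q]); (u, p, [:: v; u; w; p]);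
    (w, q, [:: v; u; w; q])])) => //.
  - by solve_valid.
  - by solve_cover v.
  - solve_wt.
subst q.
have /orP[/eqP dp|/eqP dp] : (#|nb A p| == 2) || (#|nb A p| == 3).
- by move: (D p pA); case: #|_| => [|[|[|[|]]]].
- have [|x [xA px xu hp]] := nb2 dp uA _; first by edge.
  have E : x = w by symmetry; case: (hp w wA) => // [|?]; first edge; subst; absurd constr:(2).
  subst x.
  (* The component is K4 minus the edge vp; its six pairs give 6 y^4, about 0.951. *)
  apply: (strict_branch (L := [:: (v, p, [:: v; u; w; p]); (v, u, [:: v; u; w; p]);
    (v, w, [:: v; u; w; p]); (u, w, [:: v; u; w; p]); (u, p, [:: v; u; w; p]);
    (w, p, [:: v; u; w; p])])) => //.
  - by solve_valid.
  - by solve_cover v; twin u.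
  - solve_wt.
have [|||z [zA pz zu zw hp]] := nb3 dp uA _ wA _; [edge|edge|neq|].
apply: (strict_branch (L := [:: (v, v, [:: v; u; w]); (v, u, [:: v; u; w; p]);
    (v, w, [:: v; u; w; p]); (u, w, [:: u; w; v; p]); (u, p, [:: v; u; w; p; z]);
    (w, p, [:: v; u; w; p; z])])) => //.
- by solve_valid.
- by solve_cover v.
- solve_wt.
Qed.

(** * Vertices of degree two outside triangles *)

Section MinDegreeTwo.
Hypothesis D : forall z, z \in A -> 1 < #|nb A z| <= 3.

Lemma deg23 z : z \in A -> #|nb A z| = 2 \/ #|nb A z| = 3.
Proof. by move=> /D; case: #|_| => [|[|[|[|]]]] // _; [left|right]. Qed.

Hypothesis noT2 : forall v u w, v \in A -> u \in A -> w \in A -> #|nb A v| = 2 ->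
  e v u -> e v w -> ~~ e u w.

(** If q and r are adjacent, q lies in a triangle and so has degree 3; if not, a second neighbour of
    q cannot be r. *)
Lemma outer_nbr p q r : p \in A -> q \in A -> r \in A -> e p q -> e p r ->
  exists z, [/\ z \in A, e q z, z != p & z != r].
Proof.
move=> pA qA rA pq pr; have qp : e q p by edge.
have [qr|nqr] := boolP (e q r).
  apply: nb_extra2; case: (deg23 qA) => [d|-> //].
  by have := noT2 qA pA rA d qp qr; rewrite pr.
have /andP[d _] := D qA; have [z [zA qz zp]] := nb_extra1 p d.
by exists z; split=> //; apply: contraNneq nqr => <-.
Qed.

Lemma deg2_22_strict v u w : v \in A -> u \in A -> w \in A -> e v u -> e v w -> u != w ->
  ~~ e u w -> (forall z, z \in A -> e v z -> z = u \/ z = w) ->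
  #|nb A u| = 2 -> #|nb A w| = 2 -> (g A < 1)%R.
Proof.
move=> vA uA wA vu vw nuw uw hv du dw.
have [|p [pA up pv hu]] := nb2 du vA _; first by edge.
have [|q [qA wq qv hw]] := nb2 dw vA _; first by edge.
have [E|npq] := eqVneq p q; last first.
  have /andP[/(nb_extra1 u) [z1 [z1A pz1 z1u]] _] := D pA.
  have /andP[/(nb_extra1 w) [z2 [z2A qz2 z2w]] _] := D qA.
  apply: (strict_branch (L := [:: (v, v, [:: v; u; w]); (v, u, [:: v; u; w; p]);
    (v, w, [:: v; u; w; q]); (u, p, [:: u; p; v; z1]); (w, q, [:: w; q; v; z2]);
    (u, w, [:: u; w; v; p; q])])) => //.
  - by solve_valid.
  - by solve_cover v.
  - solve_wt.
subst q.
case: (deg23 pA) => dp.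
  have [|x [xA px xu hp]] := nb2 dp uA _; first by edge.
  have E : x = w by symmetry; case: (hp w wA) => // [|?]; first edge; subst; absurd constr:(2).
  subst x.
  (* The component is a 4-cycle in which v and p are twins; its six pairs give 6 y^4. *)
  apply: (strict_branch (L := [:: (v, p, [:: v; u; w; p]); (v, u, [:: v; u; w; p]);
    (v, w, [:: v; u; w; p]); (u, w, [:: v; u; w; p]); (u, p, [:: v; u; w; p]);
    (w, p, [:: v; u; w; p])])) => //.
  - by solve_valid.
  - by solve_cover v; twin u.
  - solve_wt.
have [|||z [zA pz zu zw hp]] := nb3 dp uA _ wA _; [edge|edge|neq|].
apply: (strict_branch (L := [:: (v, v, [:: v; u; w]); (v, u, [:: v; u; w; p]);
    (v, w, [:: v; u; w; p]); (u, w, [:: u; w; v; p]); (u, p, [:: v; u; w; p; z]);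
    (w, p, [:: v; u; w; p; z])])) => //.
- by solve_valid.
- by solve_cover v.
- solve_wt.
Qed.

Lemma deg2_32_strict v u w : v \in A -> u \in A -> w \in A -> e v u -> e v w -> u != w ->
  ~~ e u w -> (forall z, z \in A -> e v z -> z = u \/ z = w) ->
  #|nb A u| = 3 -> #|nb A w| = 2 -> (g A < 1)%R.
Proof.
move=> vA uA wA vu vw nuw uw hv du dw.
have [|p [p' [[pA up pA' up'] [pv pv' npp hu]]]] := nb3_1 du vA _; first by edge.
have [|q [qA wq qv hw]] := nb2 dw vA _; first by edge.
have [z1 [z1A pz1 z1u z1p]] := outer_nbr uA pA pA' up up'.
have [z2 [z2A pz2 z2u z2p]] := outer_nbr uA pA' pA up' up.
have /andP[/(nb_extra1 w) [z3 [z3A qz3 z3w]] _] := D qA.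
apply: (strict_branch (L := [:: (v, v, [:: v; u; w]); (v, u, [:: v; u; w; p; p']);
    (v, w, [:: v; u; w; q]); (u, p, [:: u; v; p; p'; z1]); (u, p', [:: u; v; p; p'; z2]);
    (w, q, [:: w; q; v; z3]); (u, w, [:: u; w; v; p; p'])])) => //.
- by solve_valid.
- by solve_cover v.
- solve_wt.
Qed.

(** Every listed pair of distinct vertices dominates at least five vertices, so the total is y^3 + 7
    y^5, about 0.951. *)
Lemma deg2_33_strict v u w : v \in A -> u \in A -> w \in A -> e v u -> e v w -> u != w ->
  ~~ e u w -> (forall z, z \in A -> e v z -> z = u \/ z = w) ->
  #|nb A u| = 3 -> #|nb A w| = 3 -> (g A < 1)%R.
Proof.
move=> vA uA wA vu vw nuw uw hv du dw.
have [|p [p' [[pA up pA' up'] [pv pv' npp hu]]]] := nb3_1 du vA _; first by edge.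
have [|q [q' [[qA wq qA' wq'] [qv qv' nqq hw]]]] := nb3_1 dw vA _; first by edge.
have [z1 [z1A pz1 z1u z1p]] := outer_nbr uA pA pA' up up'.
have [z2 [z2A pz2 z2u z2p]] := outer_nbr uA pA' pA up' up.
have [z3 [z3A qz3 z3w z3q]] := outer_nbr wA qA qA' wq wq'.
have [z4 [z4A qz4 z4w z4q]] := outer_nbr wA qA' qA wq' wq.
apply: (strict_branch (L := [:: (v, v, [:: v; u; w]); (v, u, [:: v; u; w; p; p']);
    (v, w, [:: v; u; w; q; q']); (u, p, [:: u; v; p; p'; z1]); (u, p', [:: u; v; p; p'; z2]);
    (w, q, [:: w; v; q; q'; z3]); (w, q', [:: w; v; q; q'; z4]);
    (u, w, [:: u; w; v; p; p'])])) => //.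
- by solve_valid.
- by solve_cover v.
- solve_wt.
Qed.

Lemma deg2_strict v : v \in A -> #|nb A v| = 2 -> (g A < 1)%R.
Proof.
move=> vA dv; have [|u [uA vu _]] := @nb_extra A v [::]; first by rewrite dv.
have [w [wA vw wu hv]] := nb2 dv uA vu.
have uw := noT2 vA uA wA dv vu vw; have wu' : ~~ e w u by rewrite eS.
have uw' : u != w by neq.
have hv' z : z \in A -> e v z -> z = w \/ z = u by move=> zA /(hv z zA) []; tauto.
case: (deg23 uA) => du; case: (deg23 wA) => dw.
- exact: (deg2_22_strict vA uA wA).
- exact: (deg2_32_strict vA wA uA).
- exact: (deg2_32_strict vA uA wA).
- exact: (deg2_33_strict vA uA wA).
Qed.
End MinDegreeTwo.

(** Sets avoiding v remain maximal when v is deleted, and by induction they contribute at most y;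
    closed pairs then have to cover only the sets containing v. *)
Lemma branch_vertex v (r : R) : v \in A ->
  (INR #|[set F in mds A | v \in F]| * y ^ #|A| <= r)%R -> (g A <= y + r)%R.
Proof.
move=> vA hr; have pr : A :\ v \proper A by apply: properD1.
set X := [set F in mds A | v \in F] in hr *; set Z := [set F in mds A | v \notin F].
have cX : #|mds A| = #|Z| + #|X|.
  rewrite addnC -(cardsID [set F : {set T} | v \in F] (mds A)); congr (_ + _);
    by apply: eq_card => F; rewrite !inE; case: (v \in F); rewrite ?andbT ?andbF.
have ZS : #|Z| <= #|mds (A :\ v)|.
  apply: subset_leq_card; apply/subsetP => F; rewrite inE => /andP[/mdsP[sF dF mF] vF].
  apply/mdsP; split=> //; first by rewrite subsetD1 sF vF.
  by move=> w; rewrite !inE => /andP[_ wA]; apply: mF.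
have hZ : (INR #|Z| * y ^ #|A| <= y)%R.
  have := IH pr; rewrite /g (cardsD1 v A) vA add1n => h; rewrite -tech_pow_Rmult.
  have h1 := le_INR _ _ (elimT leP ZS); have h2 := pow_lt y #|A :\ v| y_gt0.
  have h3 : (INR #|Z| * y ^ #|A :\ v| <= 1)%R by nra.
  have := y_gt0; nra.
rewrite /g cX -plusE plus_INR; lra.
Qed.

Variant member_spec F v : Prop :=
| MemberSelf of closed_pair F v v
| MemberNbr u of u \in A & e v u & closed_pair F v u.

Lemma member F v : F \in mds A -> v \in F -> member_spec F v.
Proof.
move=> mF vF; have [h|[u [uA _ vu] c]] := mds_in mF vF; first exact: MemberSelf.
exact: (MemberNbr uA vu c).
Qed.

Ltac solve_member := let F := fresh "F" in let mF := fresh "mF" in let vF := fresh "vF" in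
  move=> F mF vF; case: (member mF vF);
  [ move=> ?; try found | let u := fresh "u" in move=> u ? ? ?; nbs_of u; try found ].

(** * Cubic graphs: K4, diamonds, triangles, triangle-free *)

Section Cubic.
Hypothesis cubic : forall z, z \in A -> #|nb A z| = 3.

Lemma K4_strict v a b c : v \in A -> a \in A -> b \in A -> c \in A ->
  e v a -> e v b -> e v c -> e a b -> e a c -> e b c -> (g A < 1)%R.
Proof.
move=> vA aA bA cA va vb vc ab ac bc.
have n1 : a != b by neq. have n2 : a != c by neq. have n3 : b != c by neq.
have n4 : v != a by neq. have n5 : v != b by neq. have n6 : v != c by neq.
have [x [xA vx xa xb hv]] := nb3 (cubic vA) aA va bA vb n1.
have E : c = x by case: (hv c cA vc) => // ?; subst; absurd constr:(1).
subst x.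
have [||x' [xA' ax' xa' xb' ha]] := nb3 (cubic aA) bA ab vA _ _; [by edge|neq|].
have E : c = x' by case: (ha c cA ac) => // ?; subst; absurd constr:(1).
subst x'.
have [|||x' [xA'' bx' xa'' xb'' hb]] := nb3 (cubic bA) aA _ vA _ _; [by edge|by edge|neq|].
have E : c = x' by case: (hb c cA bc) => // ?; subst; absurd constr:(1).
subst x'.
have [|||x' [xA3 cx' xa3 xb3 hc]] := nb3 (cubic cA) aA _ vA _ _; [by edge|by edge|neq|].
have E : b = x' by case: (hc b bA) => // [|?|?]; [edge|subst; absurd constr:(1)..].
subst x'.
apply: (strict_branch (L := [:: (v, a, [:: v; a; b; c]); (v, b, [:: v; a; b; c]);
  (v, c, [:: v; a; b; c]); (a, b, [:: v; a; b; c]); (a, c, [:: v; a; b; c]);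
  (b, c, [:: v; a; b; c])])) => //.
- by solve_valid.
- by solve_cover v; lone a.
- solve_wt.
Qed.

(** If b and c are not adjacent, the sets containing v are covered by three pairs: v is never
    isolated, as all neighbours of a lie in N[v]. The total y + y^4 + 2 y^5 is about 0.989. *)
Lemma diamond_strict v a b c : v \in A -> a \in A -> b \in A -> c \in A ->
  e v a -> e v b -> e v c -> e a b -> e a c -> b != c -> (g A < 1)%R.
Proof.
move=> vA aA bA cA va vb vc ab ac nbc.
have [bc|bc] := boolP (e b c); first exact: (K4_strict vA aA bA cA).
have n1 : a != b by neq. have n2 : a != c by neq.
have n4 : v != a by neq. have n5 : v != b by neq. have n6 : v != c by neq.
have [x [xA vx xa xb hv]] := nb3 (cubic vA) aA va bA vb n1.
have E : c = x by case: (hv c cA vc) => // ?; subst; absurd constr:(1).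
subst x.
have [||x' [xA' ax' xa' xb' ha]] := nb3 (cubic aA) bA ab vA _ _; [by edge|neq|].
have E : c = x' by case: (ha c cA ac) => // ?; subst; absurd constr:(1).
subst x'.
have [|||b' [bA' bb' ba' bv' hb]] := nb3 (cubic bA) aA _ vA _ _; [by edge|by edge|neq|].
have [|||c' [cA' cc' ca' cv' hc]] := nb3 (cubic cA) aA _ vA _ _; [by edge|by edge|neq|].
pose L : seq item := [:: (v, a, [:: v; a; b; c]); (v, b, [:: v; a; b; c; b']);
  (v, c, [:: v; a; b; c; c'])].
have hL : (wt L < 1 - y)%R by solve_wt.
suff : (g A <= y + wt L)%R by lra.
apply: (branch_vertex vA); apply: branch => //; rewrite /L; first by solve_valid.
by solve_member; lone a.
Qed.

Lemma triangle_strict v a b : v \in A -> a \in A -> b \in A ->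
  e v a -> e v b -> e a b -> (g A < 1)%R.
Proof.
move=> vA aA bA va vb ab.
have n1 : a != b by neq. have n4 : v != a by neq. have n5 : v != b by neq.
have [c [cA vc ca cb hv]] := nb3 (cubic vA) aA va bA vb n1.
have [||a' [aA' aa' ab' av' ha]] := nb3 (cubic aA) bA ab vA _ _; [by edge|neq|].
have [|||b' [bA' bb' ba' bv' hb]] := nb3 (cubic bA) aA _ vA _ _; [by edge|by edge|neq|].
(* A coincidence among the third neighbours a', b', c of a, b, v yields two triangles sharing an
   edge. *)
have [E|nac] := eqVneq a' c.
  by subst a'; apply: (diamond_strict vA aA bA cA); rewrite // eq_sym.
have [E|nbc] := eqVneq b' c.
  by subst b'; apply: (diamond_strict vA bA aA cA); rewrite ?[a == _]eq_sym //; edge.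
have [E|nab] := eqVneq a' b'.
  by subst b'; apply: (diamond_strict aA bA vA aA'); rewrite ?[v == _]eq_sym //; edge.
have [|c1 [c2 [[cA1 cc1 cA2 cc2] [c1v c2v c12 hc]]]] := nb3_1 (cubic cA) vA _; first by edge.
have [|a1 [a2 [[aA1 aa1 aA2 aa2] [a1v a2v a12 ha']]]] := nb3_1 (cubic aA') aA _; first by edge.
have [|b1 [b2 [[bA1 bb1 bA2 bb2] [b1v b2v b12 hb']]]] := nb3_1 (cubic bA') bA _; first by edge.
have [z1 [z1A cz1 z1c z1c2]] : exists z, [/\ z \in A, e c1 z, z != c & z != c2].
  by apply: nb_extra2; rewrite cubic.
have [z2 [z2A cz2 z2c z2c2]] : exists z, [/\ z \in A, e c2 z, z != c & z != c1].
  by apply: nb_extra2; rewrite cubic.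
(* The pairs {a, c} and {b, c} serve the case of two isolated neighbours of v. The total y^4 + 5 y^5
   + 5 y^6 is about 0.974. *)
apply: (strict_branch (L := [:: (v, v, [:: v; a; b; c]); (v, a, [:: v; a; b; c; a']);
  (v, b, [:: v; a; b; c; b']); (v, c, [:: v; c; a; b; c1; c2]); (a, b, [:: a; b; v; a'; b']);
  (a, a', [:: a; a'; v; b; a1; a2]); (b, b', [:: b; b'; v; a; b1; b2]);
  (c, c1, [:: c; v; c1; c2; z1]); (c, c2, [:: c; v; c1; c2; z2]);
  (a, c, [:: a; c; v; b; c1; c2]); (b, c, [:: b; c; v; a; c1; c2])])) => //.
- by solve_valid.
- by solve_cover v.
- solve_wt.
Qed.

Hypothesis triangle_free : forall p q r, p \in A -> q \in A -> r \in A ->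
  e p q -> e p r -> ~~ e q r.

(** Without triangles, the two further neighbours of p and the two of q are four distinct
    vertices. *)
Lemma dom_edge p q : p \in A -> q \in A -> e p q ->
  exists2 s, valid A (p, q, s) & size s = 6.
Proof.
move=> pA qA pq.
have [r [s [[rA pr sA ps] [rq sq sr hp]]]] := nb3_1 (cubic pA) qA pq.
have [|t [u [[tA qt uA qu] [tp up ut hq]]]] := nb3_1 (cubic qA) pA _; first by edge.
have nqr := triangle_free pA qA rA pq pr. have nqs := triangle_free pA qA sA pq ps.
by exists [:: p; q; r; s; t; u] => //; solve_valid.
Qed.

Lemma triangle_free_strict v : v \in A -> (g A < 1)%R.
Proof.
move=> vA; have [|a [aA va _]] := @nb_extra A v [::]; first by rewrite cubic.
have [b [c [[bA vb cA vc] [ba ca cb hv]]]] := nb3_1 (cubic vA) aA va.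
have nab := triangle_free vA aA bA va vb.
have nac := triangle_free vA aA cA va vc.
have nbc := triangle_free vA bA cA vb vc.
have [|a1 [a2 [[aA1 aa1 aA2 aa2] [a1v a2v a12 ha]]]] := nb3_1 (cubic aA) vA _; first by edge.
have [|b1 [b2 [[bA1 bb1 bA2 bb2] [b1v b2v b12 hb]]]] := nb3_1 (cubic bA) vA _; first by edge.
have [|c1 [c2 [[cA1 cc1 cA2 cc2] [c1v c2v c12 hc]]]] := nb3_1 (cubic cA) vA _; first by edge.
have [s1 V1 S1] := dom_edge vA aA va. have [s2 V2 S2] := dom_edge vA bA vb.
have [s3 V3 S3] := dom_edge vA cA vc. have [s4 V4 S4] := dom_edge aA aA1 aa1.
have [s5 V5 S5] := dom_edge aA aA2 aa2. have [s6 V6 S6] := dom_edge bA bA1 bb1.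
have [s7 V7 S7] := dom_edge bA bA2 bb2. have [s8 V8 S8] := dom_edge cA cA1 cc1.
have [s9 V9 S9] := dom_edge cA cA2 cc2.
(* Two isolated neighbours of v either include a, covered by the singleton a, or are b and c. The
   total 2 y^4 + y^5 + 9 y^6 is about 0.985. *)
apply: (strict_branch (L := [:: (v, v, [:: v; a; b; c]); (v, a, s1); (v, b, s2);
  (v, c, s3); (a, a1, s4); (a, a2, s5); (b, b1, s6); (b, b2, s7); (c, c1, s8); (c, c2, s9);
  (a, a, [:: a; v; a1; a2]); (b, c, [:: b; c; v; b1; b2])])) => //.
- by rewrite /= V1 V2 V3 V4 V5 V6 V7 V8 V9; clear V1 V2 V3 V4 V5 V6 V7 V8 V9; solve_valid.
- by solve_cover v.
- rewrite /wt /= S1 S2 S3 S4 S5 S6 S7 S8 S9; solve_wt.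
Qed.
End Cubic.

Lemma cubic_strict v : v \in A -> (forall z, z \in A -> #|nb A z| = 3) -> (g A < 1)%R.
Proof.
move=> vA cubic.
have [/existsP[p /existsP[q /existsP[r /and5P[pA qA rA pq /andP[pr qr]]]]]|h] :=
  boolP [exists p, exists q, exists r, [&& p \in A, q \in A, r \in A, e p q & e p r && e q r]].
  exact: (triangle_strict cubic pA qA rA).
apply: (triangle_free_strict cubic _ vA) => p q r pA qA rA pq pr.
apply: contra h => qr; apply/existsP; exists p; apply/existsP; exists q; apply/existsP.
by exists r; rewrite pA qA rA pq pr qr.
Qed.

(** * Leaves and vertices of degree at least four *)

Lemma wt_map_le (u : T) (f : T -> seq T) (l : seq T) k :
  (forall w, w \in l -> k <= size (f w)) ->
  (wt [seq (u, w, f w) | w <- l] <= INR (size l) * y ^ k)%R.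
Proof.
elim: l => [|w l IHl] h; first by rewrite /=; lra.
rewrite [size _]/= S_INR /=.
have h1 := pow_y_le (h w (mem_head _ _)).
have := IHl (fun z zl => h z (mem_behead (s := w :: l) zl)); lra.
Qed.

Lemma valid_dom v u : valid A (v, u, enum (dom A v u)).
Proof. by rewrite /valid enum_uniq; apply/allP => z; rewrite /= mem_enum. Qed.

Lemma self_nb v : v \notin nb A v.
Proof. by rewrite inE eI andbF. Qed.

Lemma nb_dom v u : v \in A -> v |: nb A v \subset dom A v u.
Proof.
move=> vA; apply/subsetP => z; rewrite !inE => /predU1P[->|/andP[zA vz]].
  by rewrite vA eqxx.
by rewrite zA vz !orbT.
Qed.

Lemma card_dom v u : v \in A -> #|nb A v| < #|dom A v u|.
Proof.
by move=> vA; have := subset_leq_card (nb_dom u vA); rewrite cardsU1 self_nb.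
Qed.

Lemma card_dom_outer v u z : v \in A -> z \in A -> e u z -> z != v -> ~~ e v z ->
  #|nb A v|.+1 < #|dom A v u|.
Proof.
move=> vA zA uz zv vz; have : z |: (v |: nb A v) \subset dom A v u.
  by rewrite subUset nb_dom // sub1set inE zA uz !orbT.
move=> /subset_leq_card; rewrite !cardsU1 self_nb !inE negb_or zv negb_and vz orbT.
by rewrite add1n add1n.
Qed.

Lemma leaf_strict v : v \in A -> #|nb A v| = 1 -> (g A < 1)%R.
Proof.
move=> vA dv; have [|u [uA vu _]] := @nb_extra A v [::]; first by rewrite dv.
have hv := nb1 dv uA vu; have uv : e u v by edge.
pose L : seq item := (v, v, [:: v; u]) ::
  [seq (u, w, enum (dom A u w)) | w <- enum (nb A u)].
apply: (strict_branch (L := L)) => //.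
- rewrite /L /= all_map; apply/andP; split; first by solve_valid.
  by apply/allP => w _; apply: valid_dom.
- have fd F w : w \in A -> e u w -> closed_pair F u w ->
      has (fun i : item => closed_pair F i.1.1 i.1.2) L.
    move=> wA uw c; rewrite /L /= has_map; apply/orP; right; apply/hasP; exists w => //.
    by rewrite mem_enum inE wA.
  move=> F mF; case: (around mF vA).
  + by move=> c; rewrite /= c.
  + by move=> x xA /(hv x xA) -> c; apply: (fd F v) => //; rewrite closed_pairC.
  + by move=> x w xA /(hv x xA) -> wA uw _ c; apply: (fd F w).
  + by move=> x w xA /(hv x xA) -> wA /(hv w wA) ->; rewrite eqxx.
rewrite [wt _]/=.
have h1 : (wt [seq (u, w, enum (dom A u w)) | w <- enum (nb A u)] <=
           INR #|nb A u| * y ^ #|nb A u|.+1)%R.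
  by rewrite [#|nb A u| in X in INR X]cardE; apply: wt_map_le => w _;
    rewrite -cardE; apply: card_dom.
(* The bound covers degree 1, with value y^2, and degree at least 2, with value at most 2 y^3. *)
have h2 : (INR #|nb A u| * y ^ #|nb A u|.+1 <= 504 / 1000)%R.
  have [d1|d2] := leqP #|nb A u| 1; last first.
    by apply: Rle_trans (mul_pow_le (isT : 1 < 2) d2) _; have := y3_lt; rewrite /=; lra.
  have /eqP -> : #|nb A u| == 1.
    by rewrite eqn_leq d1 card_gt0; apply/set0Pn; exists v; rewrite inE vA.
  by have := y2_lt; rewrite /=; lra.
have := y2_lt; rewrite /= in h1 h2 *; lra.
Qed.

(* The vertex v is universal in the component {v, a, b, c, d} and a has degree 2. *)
Lemma pentad_strict v a b c d : v \in A -> a \in A -> b \in A -> c \in A -> d \in A ->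
  e v a -> e v b -> e v c -> e v d -> uniq [:: a; b; c; d] -> e a b ->
  (forall z, z \in A -> e v z -> z = a \/ z = b \/ z = c \/ z = d) ->
  (forall z, z \in A -> e a z -> z = v \/ z = b) ->
  (forall z, z \in A -> e b z -> z = v \/ z = a \/ z = c \/ z = d) ->
  (g A < 1)%R.
Proof.
move=> vA aA bA cA dA va vb vc vd; rewrite /= !inE !negb_or.
move=> /and4P[/and3P[nab nac nad] /andP[nbc nbd] ncd _] ab.
(* The case where b is adjacent to exactly one of the two remaining vertices, used with c and d in
   either order. *)
have one c' d' : c' \in A -> d' \in A -> e v c' -> e v d' -> a != c' -> a != d' ->
  b != c' -> b != d' -> c' != d' -> e b c' -> ~~ e b d' ->
  (forall z, z \in A -> e v z -> z = a \/ z = b \/ z = c' \/ z = d') ->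
  (forall z, z \in A -> e a z -> z = v \/ z = b) ->
  (forall z, z \in A -> e b z -> z = v \/ z = a \/ z = c' \/ z = d') -> (g A < 1)%R.
  move=> cA' dA' vc' vd' n1 n2 n3 n4 n5 bc bd hv ha hb.
  apply: (strict_branch (L := [:: (a, a, [:: a; v; b]); (a, v, [:: a; v; b; c'; d']);
    (a, b, [:: a; v; b; c']); (v, b, [:: a; v; b; c'; d']); (v, c', [:: a; v; b; c'; d']);
    (v, d', [:: a; v; b; c'; d']); (b, c', [:: a; v; b; c'])])) => //.
  - by solve_valid.
  - by solve_cover a.
  - solve_wt.
have [bc|bc] := boolP (e b c); have [bd|bd] := boolP (e b d) => hv ha hb.
- apply: (strict_branch (L := [:: (a, a, [:: a; v; b]); (a, v, [:: a; v; b; c; d]);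
    (a, b, [:: a; v; b; c; d]); (v, b, [:: a; v; b; c; d]); (v, c, [:: a; v; b; c; d]);
    (v, d, [:: a; v; b; c; d]); (b, c, [:: a; v; b; c; d]); (b, d, [:: a; v; b; c; d])])) => //.
  + by solve_valid.
  + by solve_cover a.
  + solve_wt.
- exact: (one c d).
- apply: (one d c) => // [|z zA /(hv z zA)|z zA /(hb z zA)]; [by rewrite eq_sym|tauto..].
apply: (strict_branch (L := [:: (a, v, [:: a; v; b; c; d]);
    (a, b, [:: a; v; b]); (v, b, [:: a; v; b; c; d]); (v, c, [:: a; v; b; c; d]);
    (v, d, [:: a; v; b; c; d])])) => //.
- by solve_valid.
- by solve_cover a; lone b.
- solve_wt.
Qed.

(* A component on 5 vertices with all degrees at least 3: its complement is a matching. *)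
Definition block K := [/\ K \subset A, #|K| = 5,
  forall p q, p \in K -> q \in A -> e p q -> q \in K &
  forall p, p \in K -> 2 < #|nb A p|].

(** By the closure hypothesis N[v] is a component on five vertices. A vertex of degree 1 or 2 in it
    gives the strict bound; otherwise it is a block. *)
Lemma pentad v : v \in A -> #|nb A v| = 4 ->
  (forall u z, u \in A -> e v u -> z \in A -> e u z -> z != v -> e v z) ->
  (g A < 1)%R \/ block (v |: nb A v).
Proof.
move=> vA dv cl.
have [/exists_inP[a aK da]|/exists_inPn h] := boolP [exists a in v |: nb A v, #|nb A a| <= 2].
  left; move: aK; rewrite !inE => /predU1P[E|/andP[aA va]]; first by rewrite E dv in da.
  have av : e a v by edge.
  have : 0 < #|nb A a| by rewrite card_gt0; apply/set0Pn; exists v; rewrite inE vA.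
  case Ea: #|nb A a| da => [|[|[|]]] // _ _; first exact: (leaf_strict aA).
  have [b [bA ab bv ha]] := nb2 Ea vA av.
  have vb : e v b by apply: (cl a b).
  have nab : a != b by neq.
  have [|c [cA vc]] := @nb_extra A v [:: a; b]; first by rewrite dv.
  rewrite !inE negb_or => /andP[ca cb].
  have [|d [dA vd]] := @nb_extra A v [:: a; b; c]; first by rewrite dv.
  rewrite !inE !negb_or => /and3P[nda ndb ndc].
  have U : uniq [:: a; b; c; d].
    by rewrite /= !inE !negb_or nab [a == c]eq_sym ca [a == d]eq_sym nda [b == c]eq_sym cb
      [b == d]eq_sym ndb [c == d]eq_sym ndc.
  have hv z : z \in A -> e v z -> z = a \/ z = b \/ z = c \/ z = d.
    move=> zA vz; have := @nb_all A v [:: a; b; c; d] U _ _ z zA vz.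
    rewrite /= !inE aA va bA vb cA vc dA vd dv => /(_ isT isT).
    by move=> /or4P[]/eqP; tauto.
  apply: (pentad_strict vA aA bA cA dA) => // z zA bz.
  have [->|zv] := eqVneq z v; first by left.
  by have := hv z zA (cl b z bA vb zA bz zv); case=> [|[E|]]; [tauto|rewrite E eI in bz|tauto].
right; split.
- by apply/subsetP => z; rewrite !inE => /predU1P[->//|/andP[]].
- by rewrite cardsU1 self_nb dv.
- move=> p q; rewrite !inE => /predU1P[->|/andP[pA vp]] qA pq; first by rewrite qA pq orbT.
  by have [//|qv] := eqVneq q v; rewrite qA (cl p q).
- by move=> p /h; rewrite ltnNge.
Qed.

Lemma high_degree v : v \in A -> 3 < #|nb A v| ->
  (g A < 1)%R \/ block (v |: nb A v).
Proof.
move=> vA dv; set d := #|nb A v| in dv.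
pose L s := [seq (v, u, enum (dom A v u)) | u <- s].
have vL s : all (valid A) (L s).
  by rewrite all_map; apply/allP => u _; apply: valid_dom.
have fd F s u : u \in s -> closed_pair F v u ->
    has (fun i : item => closed_pair F i.1.1 i.1.2) (L s).
  by move=> us c; rewrite has_map; apply/hasP; exists u.
have inN u : u \in A -> e v u -> u \in nb A v by rewrite inE => -> ->.
have [/exists_inP[u uN hu]|/exists_inPn out] :=
  boolP [exists u in nb A v, [forall z in A, (e u z && (z != v)) ==> e v z]]; last first.
  (* Each pair {v, u} dominates a vertex outside N[v], and y + y^(d+1) + d y^(d+2) < 1 for d >=
     4. *)
  left; have hL : (wt (L (v :: enum (nb A v))) < 1 - y)%R.
    rewrite [wt _]/=.
    have h1 : (y ^ size (enum (dom A v v)) <= y ^ d.+1)%R.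
      by apply: pow_y_le; rewrite -cardE; apply: card_dom.
    have h2 : (wt (L (enum (nb A v))) <= INR d * y ^ d.+2)%R.
      rewrite /d [#|nb A v| in X in INR X]cardE; apply: wt_map_le => w.
      rewrite mem_enum => wN; rewrite -cardE; have := out w wN; rewrite negb_forall_in.
      case/exists_inP => z zA; rewrite negb_imply => /andP[/andP[wz zv] vz].
      exact: (card_dom_outer vA zA wz).
    have h3 := pow_y_le (dv : 5 <= d.+1); have h4 := mul_pow_le (isT : 1 < 4) dv.
    rewrite -(tech_pow_Rmult y d.+1) in h2.
    have h5 : (INR 4 * y ^ 5 = 4 / 10)%R by rewrite y5 /=; lra.
    rewrite h5 in h4; rewrite y5 in h3; have := y_lt; have := y_gt0.
    rewrite /L in h2 *; nra.
  suff : (g A <= y + wt (L (v :: enum (nb A v))))%R by lra.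
  apply: (branch_vertex vA); apply: branch => // F mF vF; case: (member mF vF).
    by apply: fd; rewrite mem_head.
  by move=> x xA vx; apply: fd; rewrite inE mem_enum inN ?orbT.
(* All neighbours of u lie in N[v], so v is never isolated in F and only the d pairs {v, x}
   remain. *)
have noself F : F \in mds A -> closed_pair F v v -> False.
  move: uN; rewrite inE => /andP[uA vu] mF c.
  have [z [zF zA zv uz vz]] := isolated_nbr mF c uA vu.
  by have := forall_inP hu z zA; rewrite uz zv (negPf vz).
have bound s (t : R) : (forall x, x \in A -> e v x -> x \in s) -> (wt (L s) <= t)%R ->
    (g A <= y + t)%R.
  move=> hs hr; apply: (branch_vertex vA); apply: Rle_trans hr.
  apply: branch => // F mF vF; case: (member mF vF); first by move/(noself F mF).
  by move=> x xA vx; apply: fd; apply: hs.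
have hL : (wt (L (enum (nb A v))) <= INR d * y ^ d.+1)%R.
  rewrite /d [#|nb A v| in X in INR X]cardE; apply: wt_map_le => w _.
  by rewrite -cardE; apply: card_dom.
(* For d >= 5, y + 5 y^6 < 1 suffices. For d = 4, y + 4 y^5 exceeds 1, so a pair dominating a sixth
   vertex is needed; then y + y^6 + 3 y^5 is about 0.994. *)
move: dv; rewrite leq_eqVlt => /predU1P[d4|d5]; last first.
  left; have := mul_pow_le (isT : 1 < 5) d5.
  have h : (g A <= y + INR d * y ^ d.+1)%R.
    by apply: bound hL => x xA vx; rewrite mem_enum inN.
  have := y6_lt; have := y_lt; rewrite [INR 5]/=; lra.
have [/exists_inP[w wN]|/exists_inPn cl] :=
  boolP [exists u in nb A v, ~~ [forall z in A, (e u z && (z != v)) ==> e v z]]; last first.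
  apply: pentad => // p q pA vp qA pq qv.
  by have := cl p (inN p pA vp); rewrite negbK => /forall_inP/(_ q qA); rewrite pq qv.
rewrite negb_forall_in => /exists_inP[z zA]; rewrite negb_imply => /andP[/andP[wz zv] vz].
left; have dw : 6 <= #|dom A v w| by have := card_dom_outer vA zA wz zv vz; rewrite -/d -d4.
suff : (g A <= y + (y ^ 6 + 3 / 10))%R by have := y6_lt; have := y_lt; lra.
apply: (bound (w :: enum (nb A v :\ w))) => [x xA vx|].
  by rewrite inE mem_enum in_setD1 inN // andbT orbN.
rewrite [wt _]/=; apply: Rplus_le_compat; first by apply: pow_y_le; rewrite -cardE.
have -> : (3 / 10 = INR (size (enum (nb A v :\ w))) * y ^ 5)%R.
  rewrite -cardE y5; have := cardsD1 w (nb A v); rewrite wN -/d -d4 add1n => -[<-] /=; lra.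
by apply: wt_map_le => x _; rewrite -cardE; have := card_dom x vA; rewrite -/d -d4.
Qed.

Lemma strict_or_block : A != set0 -> (g A < 1)%R \/ exists K, block K.
Proof.
case/set0Pn => v0 v0A.
have [/exists_inP[v vA dv]|/exists_inPn le3] := boolP [exists v in A, 3 < #|nb A v|].
  by case: (high_degree vA dv) => h; [left|right; exists (v |: nb A v)].
left.
have [/exists_inP[v vA /eqP dv]|/exists_inPn n0] := boolP [exists v in A, #|nb A v| == 0].
  exact: (isolated_strict vA).
have [/exists_inP[v vA /eqP dv]|/exists_inPn n1] := boolP [exists v in A, #|nb A v| == 1].
  exact: (leaf_strict vA).
have D z : z \in A -> 1 < #|nb A z| <= 3.
  move=> zA; have := le3 z zA; have := n0 z zA; have := n1 z zA; rewrite -leqNgt.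
  by case: #|_| => [|[]].
have [/exists_inP[v vA /eqP dv]|/exists_inPn n2] := boolP [exists v in A, #|nb A v| == 2].
  have [/existsP[p /existsP[q /existsP[r /and5P[pA qA rA dp /and3P[pq pr qr]]]]]|h] :=
    boolP [exists p, exists q, exists r, [&& p \in A, q \in A, r \in A, #|nb A p| == 2
      & [&& e p q, e p r & e q r]]].
    have [x [xA px xq hp]] := nb2 (eqP dp) qA pq.
    have E : r = x by case: (hp r rA pr) => // E; rewrite E eI in qr.
    by subst x; apply: (deg2_triangle_strict pA qA rA).
  apply: (deg2_strict D _ vA dv) => p q r pA qA rA dp pq pr.
  apply: contra h => qr; apply/existsP; exists p; apply/existsP; exists q; apply/existsP.
  by exists r; rewrite pA qA rA dp pq pr qr.
apply: (cubic_strict v0A) => z zA; have := n2 z zA; have := D z zA.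
by case: #|_| => [|[|[|[|]]]].
Qed.

End Cases.

(** * Components that are K5 minus a matching *)

Section Block.
Variables A K : {set T}.
Hypothesis bK : block A K.

Lemma block_closed p q : p \in K -> q \in A -> e p q -> q \in K.
Proof. by case: bK => _ _ h _; apply: h. Qed.

Lemma block_sub p : p \in K -> p \in A.
Proof. by case: bK => /subsetP h _ _ _; apply: h. Qed.

(** A vertex of K misses at most one other vertex of K. So among three vertices of C each is
    adjacent to another, and one of them has two neighbours in C. *)
Lemma block_dissociation C : C \subset K -> dissociation e C -> #|C| <= 2.
Proof.
move=> /subsetP sC /dissP dC; rewrite leqNgt; apply/negP => /card_gt2P.
move=> [p [q [r [[pC qC rC] [pq qr rp]]]]].
have adj x x' x'' : x \in C -> x' \in C -> x'' \in C -> x != x' -> x' != x'' -> x'' != x ->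
    e x x' || e x x''.
  move=> xC x'C x''C n1 n2 n3; case: bK => _ cK cl dg; have := dg x (sC x xC).
  apply: contraTT; rewrite negb_or => /andP[e1 e2]; rewrite -leqNgt.
  have sN : nb A x \subset K :\: [set x; x'; x''].
    apply/subsetP => z; rewrite !inE => /andP[zA xz].
    rewrite (cl x z (sC x xC) zA xz) andbT !negb_or.
    by do 2?[apply/andP; split]; apply: contraTneq xz => ->; rewrite ?eI.
  apply: leq_trans (subset_leq_card sN) _; rewrite cardsDS ?cK; last first.
    by apply/subsetP => z; rewrite !inE => /orP[/orP[]|] /eqP->; apply: sC.
  by rewrite -setUA cardsU1 cards2 !inE negb_or n1 n2 eq_sym n3.
have one x x' x'' : x \in C -> x' \in C -> x'' \in C -> x' != x'' -> e x x' -> e x x'' -> False.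
  by move=> xC x'C x''C n xx' xx''; rewrite (dC x x' x'') ?eqxx in n.
have := adj p q r pC qC rC pq qr rp; have := adj q r p qC rC pC qr rp pq.
have := adj r p q rC pC qC rp pq qr; rewrite [e r p]eS [e q p]eS [e r q]eS.
case Epq: (e p q); case Eqr: (e q r); case Epr: (e p r) => // _ _ _.
- by apply: (one q p r); rewrite // 1?[p == r]eq_sym // eS.
- by apply: (one q p r); rewrite // 1?[p == r]eq_sym // eS.
- by apply: (one p q r).
- by apply: (one r q p); rewrite // 1?[q == p]eq_sym // eS.
Qed.

(** No edge leaves K, so the parts of F inside and outside K can be tested separately. *)
Lemma block_glue F G : F \subset A -> dissociation e G -> dissociation e (F :\: K) ->
  F :&: K \subset G -> dissociation e F.
Proof.
move=> /subsetP sF /dissP dG /dissP dF /subsetP sG; apply/dissP => x p q xF pF qF xp xq.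
have cl t : t \in F -> e x t -> (t \in K) = (x \in K).
  move=> tF xt; apply/idP/idP => h; last by apply: (block_closed h (sF t tF)).
  by apply: (block_closed h (sF x xF)); rewrite eS.
have [xK|xK] := boolP (x \in K).
  by apply: (dG x) => //; apply: sG; rewrite inE ?xF ?pF ?qF ?cl.
by apply: (dF x) => //; rewrite inE ?xF ?pF ?qF ?cl // xK.
Qed.

(** If F had at most one vertex in K, any other vertex of K could be added, since two vertices
    always form a dissociation set. *)
Lemma block_trace F : F \in mds A -> #|F :&: K| = 2.
Proof.
move=> /mdsP[sF dF mF]; apply/eqP; rewrite eqn_leq.
rewrite block_dissociation ?subsetIr //=; last exact: dissS (subsetIl _ _) dF.
rewrite ltnNge; apply/negP => le1.
have /subsetPn[z zK zF] : ~~ (K \subset F :&: K).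
  by apply: contraL le1 => /subset_leq_card; case: bK => _ -> _ _;
    rewrite -ltnNge; case: #|_| => [|[]].
have {}zF : z \notin F by move: zF; rewrite inE zK andbT.
have zA := block_sub zK.
case/negP: (mF z zA zF); apply: (@block_glue _ (z |: (F :&: K))).
- by rewrite subUset sub1set zA.
- have one x x' : x \in F :&: K -> x' \in F :&: K -> x = x'.
    by move=> h h'; apply: (card_le1_eqP le1).
  apply/dissP => x p q; rewrite !in_setU1 => /predU1P[->|xF].
    move=> /predU1P[->|pF]; first by rewrite eI.
    by move=> /predU1P[->|qF] _; [rewrite eI|move=> _; apply: one].
  have no t : t \in F :&: K -> ~~ e x t by move=> /(one x t xF) <-; rewrite eI.
  move=> /predU1P[->|/no/negPf-> //] /predU1P[-> //|/no/negPf-> //].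
- apply: dissS dF; apply/subsetP => x; rewrite !inE => /andP[xK /predU1P[E|//]].
  by rewrite E zK in xK.
by rewrite setIUl; apply: setSU; apply: subsetIl.
Qed.

Lemma block_rest F : F \in mds A -> F :\: K \in mds (A :\: K).
Proof.
move=> mF; have /mdsP[sF dF maxF] := mF; apply/mdsP; split.
- exact: setSD.
- exact: dissS (subsetDl _ _) dF.
move=> w; rewrite !inE => /andP[wK wA]; rewrite wK /= => wF.
apply: contra (maxF w wA wF) => dw; apply: (@block_glue _ F) => //.
- by rewrite subUset sub1set wA.
- apply: dissS dw; apply/subsetP => x; rewrite !inE => /andP[-> /predU1P[->|->]].
    by rewrite eqxx.
  by rewrite orbT.
by apply/subsetP => x; rewrite !inE => /andP[/predU1P[->|//]]; rewrite (negPf wK).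
Qed.

(** A third vertex of K never fits beside C, and a vertex outside K is blocked by the maximality of
    G. *)
Lemma block_join C G : C \subset K -> #|C| = 2 -> G \in mds (A :\: K) -> C :|: G \in mds A.
Proof.
move=> sC cC /mdsP[sG dG mG].
have disj x : x \in G -> x \notin K by move=> /(subsetP sG); rewrite inE => /andP[].
have sCG : C :|: G \subset A.
  apply/subsetP => x; rewrite inE => /orP[/(subsetP sC)/block_sub //|/(subsetP sG)].
  by rewrite inE => /andP[].
have eI' : (C :|: G) :&: K = C.
  apply/setP => x; rewrite !inE; apply/andP/idP => [[/orP[//|/disj h]]|xC].
    by rewrite (negPf h).
  by rewrite xC (subsetP sC).
have eD : (C :|: G) :\: K = G.
  apply/setP => x; rewrite !inE; apply/andP/idP => [[xK /orP[/(subsetP sC)|//]]|xG].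
    by rewrite (negPf xK).
  by rewrite xG orbT disj.
apply/mdsP; split=> //.
  apply: (@block_glue _ C); rewrite ?eI' ?eD //.
  apply/dissP => x p q xC pC qC xp xq.
  have : #|C :\ x| = 1 by have := cardsD1 x C; rewrite xC cC add1n => -[].
  move/eqP/cards1P => [t Et]; have in1 r : r \in C -> e x r -> r = t.
    by move=> rC xr; apply/set1P; rewrite -Et !inE rC andbT; apply: contraTneq xr => ->; rewrite eI.
  by rewrite (in1 p) // (in1 q).
move=> w wA; rewrite inE negb_or => /andP[wC wG].
have [wK|wK] := boolP (w \in K).
  apply/negP => d; have : #|w |: C| <= 2.
    apply: block_dissociation; first by rewrite subUset sub1set wK.
    by apply: dissS d; rewrite setUA subsetUl.
  by rewrite cardsU1 wC cC.
apply: contra (mG w _ wG) => [d|]; last by rewrite inE wK.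
by apply: dissS d; apply/subsetP => x; rewrite !inE => /predU1P[->|->]; rewrite ?eqxx ?orbT.
Qed.

Lemma card_mds_block : #|mds A| = 10 * #|mds (A :\: K)|.
Proof.
have <- : #|[set C : {set T} | C \subset K & #|C| == 2]| = 10.
  by rewrite cards_draws; case: bK => _ -> _ _.
rewrite -cardsX -(@card_in_imset _ _ (fun F => (F :&: K, F :\: K))).
  apply: eq_card => -[C G]; apply/imsetP/idP => [[F mF [-> ->]]|].
    by rewrite !inE /= subsetIr block_trace // eqxx /=; have := block_rest mF; rewrite inE.
  rewrite inE /= => /andP[]; rewrite inE => /andP[sC /eqP cC] mG.
  exists (C :|: G); first exact: block_join.
  have /mdsP[sG _ _] := mG.
  have disj x : x \in G -> x \notin K by move=> /(subsetP sG); rewrite inE => /andP[].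
  congr pair; apply/setP => x; rewrite !inE; have := disj x; have := subsetP sC x.
    by case: (x \in C) => [->|] //=; case: (x \in G) => // _ /(_ isT)/negPf->.
  by case: (x \in C) => [->|_] //=; case: (x \in G) => [/(_ isT)->|]; rewrite ?andbF.
by move=> F F' _ _ [E1 E2]; rewrite -(setID F K) E1 E2 setID.
Qed.

(** The ten traces on K cancel the factor y^5 = 1/10. *)
Lemma g_block : g A = g (A :\: K).
Proof.
have [sK cK _ _] := bK; have := gD sK; rewrite cK y5 => E.
rewrite [LHS]/g card_mds_block -multE mult_INR.
have -> : INR 10 = 10%R by rewrite /=; lra.
lra.
Qed.

End Block.

(** * Decompositions into blocks and the main induction *)

Definition decomposition (A : {set T}) (P : {set {set T}}) :=
  [/\ partition P A,
      forall K, K \in P -> #|K| = 5 /\ (forall p, p \in K -> 2 < #|nb K p|) &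
      forall K1 K2 p q, K1 \in P -> K2 \in P -> p \in K1 -> q \in K2 -> e p q -> K1 = K2].

Lemma decomposition_block A P K : decomposition A P -> K \in P -> block A K.
Proof.
move=> [pP gP eP] KP; have [cK dK] := gP K KP; split=> //.
- exact: partitionS pP KP.
- move=> p q pK qA pq; have : q \in cover P by rewrite (cover_partition pP).
  by case/bigcupP => K' K'P qK'; rewrite (eP K K' p q KP K'P pK qK' pq).
move=> p pK; apply: leq_trans (dK p pK) (subset_leq_card _).
apply/subsetP => z; rewrite !inE => /andP[zK ->].
by rewrite (subsetP (partitionS pP KP) z zK).
Qed.

Lemma decompositionD1 A P K : decomposition A P -> K \in P -> decomposition (A :\: K) (P :\ K).
Proof.
move=> [pP gP eP] KP; split.
- exact: partitionD1.
- by move=> K'; rewrite inE => /andP[_ /gP].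
by move=> K1 K2 p q; rewrite !inE => /andP[_ h1] /andP[_ h2]; apply: eP.
Qed.

Lemma decompositionU1 A P K : block A K -> decomposition (A :\: K) P ->
  decomposition A (K |: P).
Proof.
move=> bK [pP gP eP]; have [sK cK cl dK] := bK.
have sub K' q : K' \in P -> q \in K' -> q \in A /\ q \notin K.
  by move=> K'P qK'; have := subsetP (partitionS pP K'P) q qK'; rewrite inE => /andP[].
split.
- rewrite -[A](setID _ K) (setIidPr sK); apply: partitionU1 => //.
    by rewrite -card_gt0 cK.
  by rewrite disjoint_sym; apply/setDidPl; rewrite setDDl setUid.
- move=> K'; rewrite in_setU1 => /predU1P[->|/gP //]; split=> // p pK.
  apply: leq_trans (dK p pK) (subset_leq_card _).
  by apply/subsetP => z; rewrite !inE => /andP[zA pz]; rewrite pz (cl p z).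
move=> K1 K2 p q; rewrite !in_setU1 => /predU1P[->|K1P] /predU1P[->|K2P] // pK qK pq.
- by have [qA] := sub K2 q K2P qK; rewrite (cl p q).
- by have [pA] := sub K1 p K1P pK; rewrite (cl q p) // eS.
exact: (eP K1 K2 p q).
Qed.

Lemma g0 : g set0 = 1%R.
Proof.
rewrite /g cards0; have -> : mds set0 = [set set0].
  apply/setP => F; rewrite in_set1; apply/mdsP/eqP => [[]|->].
    by rewrite subset0 => /eqP.
  by split; rewrite ?sub0set //; [apply/dissP => x u w|move=> w]; rewrite inE.
by rewrite cards1 /=; lra.
Qed.

Lemma decomposition0 : decomposition set0 set0.
Proof.
split; last by move=> K1 K2 p q; rewrite inE.
  by rewrite /partition /cover big_set0 eqxx /trivIset /cover !big_set0 cards0 inE.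
by move=> K; rewrite inE.
Qed.

(** Bound and equality case go together in a strong induction on |A|: the bound on proper subsets
    feeds the case analysis, and equality passes between A and A minus a block. *)
Lemma g_le1_eq A : (g A <= 1)%R /\ (g A = 1%R <-> exists P, decomposition A P).
Proof.
have [n] := ubnP #|A|; elim: n A => // n IHn A; rewrite ltnS => leA.
have [->|A0] := eqVneq A set0.
  by rewrite g0; split; [lra|split=> // _; exists set0; apply: decomposition0].
have IH B : B \proper A -> (g B <= 1)%R /\ (g B = 1%R <-> exists P, decomposition B P).
  by move=> pB; apply: IHn; apply: leq_trans (proper_card pB) leA.
have prop K : block A K -> A :\: K \proper A.
  move=> [sK cK _ _]; have /card_gt0P[x xK] : 0 < #|K| by rewrite cK.
  apply/properP; split; first exact: subsetDl.
  by exists x; rewrite ?inE ?xK ?(subsetP sK).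
have conv P : decomposition A P -> g A = 1%R.
  move=> dP; have [pP _ _] := dP; case/set0Pn: A0 => x xA.
  have : x \in cover P by rewrite (cover_partition pP).
  case/bigcupP => K KP _; have bK := decomposition_block dP KP; rewrite (g_block bK).
  by apply/(IH _ (prop K bK)).2; exists (P :\ K); apply: decompositionD1.
case: (strict_or_block (fun B pB => (IH B pB).1) A0) => [lt1|[K bK]].
  split; first lra.
  (* Both sides of the equivalence are false here: by [conv] a decomposition would force g A = 1. *)
  by split; [lra|move=> [P /conv]].
have [h1 h2] := IH _ (prop K bK); rewrite (g_block bK); split=> //.
split; first by move=> /h2 [P dP]; exists (K |: P); apply: decompositionU1.
by move=> [P /conv]; rewrite (g_block bK).
Qed.

(** Dissociation is hereditary, so a larger dissociation set already yields a single vertex that can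
    be added. *)
Lemma phi_mds : phi e = #|mds [set: T]|.
Proof.
apply: eq_card => F; rewrite !inE /maximal_dissociation subsetT /=; congr (_ && _).
apply/forallP/forall_inP => h.
  move=> w; rewrite !inE andbT => wF; have /implyP := h (w |: F); apply.
  by apply/properP; split; [apply: subsetUr|exists w; rewrite // !inE eqxx].
move=> F'; apply/implyP => /properP[sF [w wF' wF]].
have /h : w \in [set: T] :\: F by rewrite !inE wF.
by apply: contra; apply: dissS; rewrite subUset sub1set wF'.
Qed.

End Branching.

(** * Blocks as K5 minus a matching *)

Lemma block_K5_minus (T : finType) (e : rel T) (K : {set T}) :
  symmetric e -> irreflexive e ->
  #|K| = 5 -> (forall p, p \in K -> 2 < #|nb e K p|) -> K5_minus_matching_block e K.
Proof.
move=> eS eI cK dK; pose f (i : 'I_5) : T := enum_val (cast_ord (esym cK) i).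
have f_inj : injective f by move=> i j /enum_val_inj /cast_ord_inj.
have fK i : f i \in K by apply: enum_valP.
(* [M] is the set of non-edges of G[K], transported to ['I_5] by an enumeration of K. *)
pose M := [set [set ij.1; ij.2] | ij : 'I_5 * 'I_5 & (ij.1 != ij.2) && ~~ e (f ij.1) (f ij.2)].
have MP i j : ([set i; j] \in M) = (i != j) && ~~ e (f i) (f j).
  apply/imsetP/idP => [[[k l]]|h]; last by exists (i, j); rewrite ?inE.
  rewrite inE /= => /andP[kl nkl] E; have : i \in [set k; l] by rewrite -E !inE eqxx.
  have : j \in [set k; l] by rewrite -E !inE eqxx orbT.
  have : k \in [set i; j] by rewrite E !inE eqxx.
  have : l \in [set i; j] by rewrite E !inE eqxx orbT.
  rewrite !inE => hl hk /orP[]/eqP Ej /orP[]/eqP Ei; subst.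
  - by rewrite orbb in hl; rewrite (eqP hl) eqxx in kl.
  - by rewrite eq_sym kl eS nkl.
  - by rewrite kl nkl.
  - by rewrite orbb in hk; rewrite (eqP hk) eqxx in kl.
have M2 m : m \in M -> #|m| = 2.
  by case/imsetP => -[i j]; rewrite inE /= => /andP[ij _] ->; rewrite cards2 ij.
(* Two non-edges at i would leave [f i] at most two neighbours in K; hence [M] is a matching. *)
have star i j k : [set i; j] \in M -> [set i; k] \in M -> j = k.
  rewrite !MP => /andP[ij nij] /andP[ik nik]; apply/eqP; apply: contraT => jk.
  have := dK _ (fK i); apply: contraTT => _; rewrite -leqNgt.
  have sN : nb e K (f i) \subset K :\: [set f i; f j; f k].
    apply/subsetP => z; rewrite !inE => /andP[zK iz]; rewrite zK andbT !negb_or.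
    by do 2?[apply/andP; split]; apply: contraTneq iz => ->; rewrite ?eI.
  apply: leq_trans (subset_leq_card sN) _; rewrite cardsDS ?cK; last first.
    by apply/subsetP => z; rewrite !inE => /orP[/orP[]|] /eqP->.
  by rewrite -setUA cardsU1 cards2 !inE !(inj_eq f_inj) negb_or ij ik jk.
have mem_pair m i : m \in M -> i \in m -> exists j, m = [set i; j].
  case/imsetP => -[k l] _ -> /=; rewrite !inE => /orP[]/eqP->; first by exists l.
  by exists k; rewrite setUC.
have dis m1 m2 : m1 \in M -> m2 \in M -> m1 != m2 -> [disjoint m1 & m2].
  move=> h1 h2; apply: contraR => /pred0Pn[i /andP[/= i1 i2]].
  have [j Ej] := mem_pair m1 i h1 i1; have [k Ek] := mem_pair m2 i h2 i2.
  by subst; rewrite (star i j k).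
have tM : trivIset M by apply/trivIsetP.
exists #|M|, M; split=> //.
(* Disjoint pairs among five points: 2 |M| <= 5 gives |M| <= 2. *)
- have : #|cover M| <= 5 by rewrite (leq_trans (max_card _)) ?card_ord.
  rewrite -(eqP tM) (eq_bigr (fun=> 2)) ?sum_nat_const //.
  by case: #|M| => [|[|[|n]]].
- apply/andP; split; first by apply/forall_inP => m /M2 ->.
  apply/forall_inP => m1 h1; apply/forall_inP => m2 h2; apply/implyP; exact: dis.
exists f; split=> //.
- apply/eqP; rewrite eqEcard; apply/andP; split.
    by apply/subsetP => _ /imsetP[i _ ->].
  by rewrite card_imset // cardsT card_ord cK.
move=> i j; rewrite /K5_minus MP negb_and negbK.
by case: eqVneq => [->|] //=; rewrite ?eI ?negbK.
Qed.

(** A matching removes at most one of the four edges at a vertex of K5. *)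
Lemma K5_minus_block (T : finType) (e : rel T) (K : {set T}) :
  K5_minus_matching_block e K -> #|K| = 5 /\ (forall p, p \in K -> 2 < #|nb e K p|).
Proof.
case=> [_ [M [_ /andP[_ /forall_inP mM] _ [f [f_inj <- ef]]]]].
split; first by rewrite card_imset // cardsT card_ord.
move=> _ /imsetP[i _ ->].
pose X := [set j | K5_minus M i j]; pose Y := [set j | (j != i) && ([set i; j] \in M)].
have cY : #|Y| <= 1.
  apply/card_le1_eqP => j k; rewrite !inE => /andP[ji hj] /andP[ki hk].
  have /implyP h := forall_inP (mM _ hj) _ hk; apply/eqP; apply: contraT => jk.
  have /h : [set i; j] != [set i; k].
    apply: contraNneq jk => E; have : j \in [set i; k] by rewrite -E !inE eqxx orbT.
    by rewrite !inE (negPf ji) eq_sym.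
  by move=> /pred0P d; have := d i; rewrite /= !inE eqxx.
have cX : 2 < #|X|.
  have : [set: 'I_5] \subset i |: (X :|: Y).
    apply/subsetP => j _; rewrite !inE /K5_minus [i == j]eq_sym.
    by case: (j == i) => //=; case: (_ \in M).
  move=> /subset_leq_card; rewrite cardsT card_ord => h.
  have {h}h := leq_trans h (leq_card_setU _ _).1.
  rewrite cards1 in h; have h' := (leq_card_setU X Y).1.
  have : 5 <= 1 + (#|X| + 1).
    by apply: leq_trans h _; rewrite leq_add2l (leq_trans h') // leq_add2l.
  by rewrite add1n addn1.
apply: leq_trans cX _; rewrite -(card_imset _ f_inj); apply: subset_leq_card.
by apply/subsetP => _ /imsetP[j jX ->]; rewrite inE in jX; rewrite inE imset_f ?inE // ef.
Qed.

Lemma Rpower_y n : (Rpower 10 (INR n / 5) * y ^ n = 1)%R.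
Proof.
rewrite -Rpower_pow; last exact: y_gt0.
rewrite Rpower_mult -Rpower_plus.
by rewrite (_ : (_ + _ = 0)%R) ?Rpower_O; [|lra|field].
Qed.

Theorem theorem1p1 (T : finType) (e : rel T) :
  simple_graph e ->
  (INR (phi e) <= Rpower 10 (INR #|T| / 5))%R /\
  (INR (phi e) = Rpower 10 (INR #|T| / 5) <->
     (5 %| #|T|) /\ disjoint_union_K5_minus_matchings e (#|T| %/ 5)).
Proof.
move=> [eS eI]; have [le1 eq1] := g_le1_eq eS eI [set: T].
rewrite /g -phi_mds cardsT in le1 eq1.
have yn := pow_lt y #|T| y_gt0; have Ry := Rpower_y #|T|.
(* Multiplication by y^n turns 10^(n/5) into 1 and the claim into the bound on [g]. *)
split; first by apply: (Rmult_le_reg_r _ _ _ yn); rewrite Ry.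
split=> [E|[_ [P [pP _ bP eP]]]].
  have [P [pP gP eP]] : exists P, decomposition e [set: T] P by apply/eq1; rewrite E.
  have cT : #|T| = #|P| * 5.
    by rewrite -cardsT; apply: card_uniform_partition pP => K /gP[].
  split; first by rewrite cT dvdn_mull.
  exists P; split=> //; first by rewrite cT mulnK.
  by move=> K /gP[cK dK]; apply: block_K5_minus.
apply: (Rmult_eq_reg_r (y ^ #|T|)); last lra.
rewrite Ry; apply/eq1; exists P; split=> // K KP.
exact: K5_minus_block (bP K KP).
Qed.
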